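(* The multisemigroup $\mathcal{S}_{\mathcal{P}}$ of the $2$-category $\mathcal{P}=\mathcal{P}(A,\mathcal{C})$ of dual projection functors is a monoid.
   Context: $\Bbbk$ is an algebraically closed field. $Q$ is an oriented connected tree with vertex set $Q_0=\{1,2,\dots,n\}$, $n>1$. $\mathbf{K}(Q)$ is the set of all vertices that are sinks or sources, and $\mathbf{K}'(Q)$ is the set of all $i\in\mathbf{K}(Q)$ with $\deg_Q(i)\geq 2$. $Q$ is assumed to be admissible: every vertex of degree at least $3$ belongs to $\mathbf{K}(Q)$. It is also assumed that $\mathbf{K}'(Q)\neq\varnothing$ (equivalently, $Q$ is not isomorphic to $1\to 2\to\dots\to m$). $A$ is the path algebra of $Q$ over $\Bbbk$ (a hereditary algebra with finitely many two-sided ideals). For a two-sided ideal $I$ of $A$, a dual projection functor corresponding to $I$ is any functor isomorphic to $\mathrm{Dp}_I=I\otimes_A{}_-$ on the category $A\text{-}\mathrm{mod}$ of finitely generated left modules. Fix a small category $\mathcal{C}$ equivalent to $A\text{-}\mathrm{mod}$. The $2$-category $\mathcal{P}=\mathcal{P}(A,\mathcal{C})$ has one object $\clubsuit$ (identified with $\mathcal{C}$); its $1$-morphisms are endofunctors of $\mathcal{C}$ in the additive closure of the identity functor and all dual projection functors (transported to $\mathcal{C}$); its $2$-morphisms are all natural transformations. The multisemigroup $\mathcal{S}_{\mathcal{P}}$ is the set of isomorphism classes of indecomposable $1$-morphisms of $\mathcal{P}$ with an added external zero element $0$, with the multivalued operation: $[\mathrm{F}]\star[\mathrm{G}]$ is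 the set of all $[\mathrm{H}]$ with $\mathrm{H}$ isomorphic to an (indecomposable) direct summand of $\mathrm{F}\circ\mathrm{G}$ if $\mathrm{F}\circ\mathrm{G}\neq0$, and $0$ otherwise. Being a monoid means that this operation is single-valued and makes $\mathcal{S}_{\mathcal{P}}$ an ordinary monoid. *)

(* Defs.v *)
From HB Require Import structures.
From mathcomp Require Import all_boot all_order all_algebra.
From mathcomp Require Import finmap boolp.
From mathcomp.multinomials Require Import monalg.

Set Implicit Arguments.
Unset Strict Implicit.
Unset Printing Implicit Defensive.

Import GRing.Theory.
Local Open Scope ring_scope.

(* A quiver on the vertex set 'I_n is given by its arrow relation: [e i j] means
   that there is an arrow i -> j.  Multiple arrows cannot occur in a tree. *)

Section Quiver.
Variables (n : nat) (e : rel 'I_n).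

Definition adjacent : rel 'I_n := fun i j => e i j || e j i.

(* A tree is a connected simple graph without cycles; a cycle of a simple graph
   has at least three vertices.  Asymmetry of [e] says that each edge receives
   exactly one orientation and that there are no loops. *)
Definition oriented_tree : Prop :=
  [/\ forall i j, e i j -> ~~ e j i,
      forall i j, connect adjacent i j
    & forall c : seq 'I_n, (2 < size c)%N -> ~ ucycle adjacent c].

Definition deg (i : 'I_n) : nat := #|[set j | adjacent i j]|.
Definition is_sink (i : 'I_n) : bool := [forall j, ~~ e i j].
Definition is_source (i : 'I_n) : bool := [forall j, ~~ e j i].
Definition Kset : {set 'I_n} := [set i | is_sink i || is_source i].
Definition Kset' : {set 'I_n} := [set i in Kset | (2 <= deg i)%N].
Definition admissible : Prop := forall i, (3 <= deg i)%N -> i \in Kset.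

(* The path i_0 -> i_1 -> ... -> i_m is encoded as (i_0, [:: i_1; ...; i_m]);
   m = 0 gives the trivial path at i_0. *)
Record qpath : predArgType :=
  QPath { qval : 'I_n * seq 'I_n; _ : path e qval.1 qval.2 }.
HB.instance Definition _ := [isSub for qval].
HB.instance Definition _ := [Choice of qpath by <:].

Definition psource (p : qpath) : 'I_n := (val p).1.
Definition ptarget (p : qpath) : 'I_n := last (val p).1 (val p).2.
Definition ptriv (i : 'I_n) : qpath := @QPath (i, [::]) isT.

(* [pconc p q] is "first q, then p", when the target of q is the source of p. *)
Definition pconc (p q : qpath) : option qpath :=
  if ptarget q == psource p then insub (psource q, (val q).2 ++ (val p).2)
  else None.

Lemma pconcE (p q : qpath) : ptarget q == psource p ->
  exists2 r, pconc p q = Some r & val r = (psource q, (val q).2 ++ (val p).2).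
Proof.
move=> h; rewrite /pconc h.
have P : path e (psource q) ((val q).2 ++ (val p).2).
  by rewrite cat_path -/(ptarget q) (eqP h) (valP q) (valP p).
case: insubP => [r _ vr|]; first by exists r.
by rewrite P.
Qed.

Lemma pconcN (p q : qpath) : ptarget q == psource p = false -> pconc p q = None.
Proof. by rewrite /pconc => ->. Qed.

Lemma pconc_st (p q r : qpath) : pconc p q = Some r ->
  psource r = psource q /\ ptarget r = ptarget p.
Proof.
have [h|/negbTE/pconcN->//] := boolP (ptarget q == psource p).
have [s -> vs] := pconcE h; case=> <-; rewrite /psource /ptarget vs.
by rewrite last_cat -/(ptarget q) (eqP h).
Qed.

Lemma pconcA (p q r : qpath) :
  obind (pconc p) (pconc q r) = obind (pconc^~ r) (pconc p q).
Proof.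
have [h1|/negbTE h1] := boolP (ptarget r == psource q);
have [h2|/negbTE h2] := boolP (ptarget q == psource p).
- have [s E vs] := pconcE h1; have [t F vt] := pconcE h2.
  have [_ ts] := pconc_st E; have [st _] := pconc_st F.
  rewrite E F /=.
  have h3 : ptarget s == psource p by rewrite ts.
  have h4 : ptarget r == psource t by rewrite st.
  have [u -> vu] := pconcE h3; have [v -> vv] := pconcE h4.
  congr Some; apply: val_inj; rewrite vu vv vt /psource vs /=.
  by rewrite catA.
- have [s E vs] := pconcE h1; have [_ ts] := pconc_st E.
  by rewrite E (pconcN h2) /= pconcN // ts.
- have [t F vt] := pconcE h2; have [st _] := pconc_st F.
  by rewrite F (pconcN h1) /= pconcN // st.
- by rewrite !pconcN.
Qed.

Lemma pconc1p i p : pconc (ptriv i) p = if ptarget p == i then Some p else None.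
Proof.
case: ifP => h; last by rewrite pconcN.
have [|r -> vr] := @pconcE (ptriv i) p; first by rewrite h.
by congr Some; apply: val_inj; rewrite vr /= cats0 /psource -surjective_pairing.
Qed.

Lemma pconcp1 i p : pconc p (ptriv i) = if i == psource p then Some p else None.
Proof.
case: ifP => h; last by rewrite pconcN.
have [|r -> vr] := @pconcE p (ptriv i); first by rewrite -(eqP h).
by congr Some; apply: val_inj; rewrite vr /= [psource _](eqP h) /psource -surjective_pairing.
Qed.

End Quiver.

(* The free k-module on all paths, of any length; its product [pathmul] is the
   bilinear extension of [pconc].  With the convention "first q, then p", left
   modules are representations of the quiver. *)

Definition pathalg (k : closedFieldType) (n : nat) (e : rel 'I_n) : Type :=
  {malg k[qpath e]}.

Section PathAlgebra.
Variables (k : closedFieldType) (n : nat) (e : rel 'I_n).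
Local Notation A := (pathalg k e).

HB.instance Definition _ := GRing.Lmodule.on A.

Definition pathmulU (p q : qpath e) (c : k) : A :=
  if pconc p q is Some r then << c *g r >> else 0.

Definition pathmul (f g : A) : A :=
  \sum_(p <- msupp f) \sum_(q <- msupp g) pathmulU p q (f@_p * g@_q).

Definition pathone : A := \sum_(i < n) << ptriv e i >>.

Lemma pathmulU0 p q : pathmulU p q 0 = 0.
Proof. by rewrite /pathmulU; case: pconc => // r; rewrite monalgU0. Qed.

Lemma pathmulUD p q c d : pathmulU p q (c + d) = pathmulU p q c + pathmulU p q d.
Proof. by rewrite /pathmulU; case: pconc => [r|]; rewrite ?addr0 // monalgUD. Qed.

Lemma pathmulw (d1 d2 : {fset qpath e}) (f g : A) :
  (msupp f `<=` d1)%fset -> (msupp g `<=` d2)%fset ->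
  pathmul f g = \sum_(p <- d1) \sum_(q <- d2) pathmulU p q (f@_p * g@_q).
Proof.
move=> le1 le2; rewrite /pathmul (big_fset_incl _ le1) /=.
  apply/eq_bigr=> p _; apply/big_fset_incl => // q _ /mcoeff_outdom ->.
  by rewrite mulr0 pathmulU0.
move=> p _ /mcoeff_outdom fp; rewrite big1 // => q _.
by rewrite fp mul0r pathmulU0.
Qed.

Lemma pathmulDl : left_distributive pathmul +%R.
Proof.
move=> f1 f2 g; have s := fsubset_refl (msupp g).
rewrite (pathmulw (fsubsetUl (msupp f1) (msupp f2)) s) (pathmulw (fsubsetUr (msupp f1) (msupp f2)) s).
rewrite (pathmulw (msuppD_le f1 f2) s) -big_split; apply/eq_bigr=> p _.
rewrite -big_split; apply/eq_bigr=> q _ /=.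
by rewrite mcoeffD mulrDl pathmulUD.
Qed.

Lemma pathmulDr : right_distributive pathmul +%R.
Proof.
move=> g f1 f2; have s := fsubset_refl (msupp g).
rewrite (pathmulw s (fsubsetUl (msupp f1) (msupp f2))) (pathmulw s (fsubsetUr (msupp f1) (msupp f2))).
rewrite (pathmulw s (msuppD_le f1 f2)) -big_split; apply/eq_bigr=> p _.
rewrite -big_split; apply/eq_bigr=> q _ /=.
by rewrite mcoeffD mulrDr pathmulUD.
Qed.

Lemma pathmul0g g : pathmul 0 g = 0.
Proof. by apply: (addrI (pathmul 0 g)); rewrite -pathmulDl !addr0. Qed.

Lemma pathmulg0 g : pathmul g 0 = 0.
Proof. by apply: (addrI (pathmul g 0)); rewrite -pathmulDr !addr0. Qed.

Lemma pathmul_suml I (r : seq I) (F : I -> A) g :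
  pathmul (\sum_(i <- r) F i) g = \sum_(i <- r) pathmul (F i) g.
Proof. exact: (big_morph (pathmul^~ g) (fun _ _ => pathmulDl _ _ _) (pathmul0g _)). Qed.

Lemma pathmul_sumr I (r : seq I) (F : I -> A) g :
  pathmul g (\sum_(i <- r) F i) = \sum_(i <- r) pathmul g (F i).
Proof. exact: (big_morph (pathmul g) (fun _ _ => pathmulDr _ _ _) (pathmulg0 _)). Qed.

Lemma pathmulUU p q c d :
  pathmul << c *g p >> << d *g q >> = pathmulU p q (c * d).
Proof. by rewrite (pathmulw msuppU_le msuppU_le) !big_seq_fset1 !mcoeffUU. Qed.

Lemma pathE (f : A) : f = \sum_(p <- msupp f) (<< f@_p *g p >> : A).
Proof. exact: monalgE. Qed.

Section Abstract.
(* The ring axioms, with the monomials << c *g p >> made opaque. *)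
Variables (mul : A -> A -> A) (u : qpath e -> k -> A).
Hypothesis uE : forall f, f = \sum_(p <- msupp f) u p f@_p.
Hypothesis mull : forall I (r : seq I) (F : I -> A) g,
  mul (\sum_(i <- r) F i) g = \sum_(i <- r) mul (F i) g.
Hypothesis mulr : forall I (r : seq I) (F : I -> A) g,
  mul g (\sum_(i <- r) F i) = \sum_(i <- r) mul g (F i).
Hypothesis mulU : forall p q a b,
  mul (u p a) (u q b) = if pconc p q is Some r then u r (a * b) else 0.

Let mul0g g : mul 0 g = 0.
Proof. by have := @mull nat [::] (fun=> 0) g; rewrite !big_nil. Qed.

Let mulg0 g : mul g 0 = 0.
Proof. by have := @mulr nat [::] (fun=> 0) g; rewrite !big_nil. Qed.

Lemma abs_mulA : associative mul.
Proof.
move=> f g h; rewrite (uE f) !mull; apply: eq_bigr => p _.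
move: (f@_p) => a; rewrite (uE g) mull !mulr mull; apply: eq_bigr => q _.
move: (g@_q) => b; rewrite (uE h) !mulr; apply: eq_bigr => r _.
move: (h@_r) => c; rewrite !mulU; have := pconcA p q r.
case: (pconc q r) => [s|]; case: (pconc p q) => [t|] /= E.
- by rewrite !mulU E mulrA.
- by rewrite mulU E mul0g.
- by rewrite mulU -E mulg0.
- by rewrite mulg0 mul0g.
Qed.

Lemma abs_mul1 : left_id (\sum_(i < n) u (ptriv e i) 1) mul.
Proof.
move=> f; rewrite {2}(uE f) {1}(uE f) mulr; apply/eq_bigr=> p _.
move: (f@_p) => c; rewrite mull (bigD1 (ptarget p)) //= big1 ?addr0.
  by rewrite mulU pconc1p eqxx mul1r.
by move=> i ip; rewrite mulU pconc1p eq_sym (negbTE ip).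
Qed.

Lemma abs_mulg1 : right_id (\sum_(i < n) u (ptriv e i) 1) mul.
Proof.
move=> f; rewrite {2}(uE f) {1}(uE f) mull; apply/eq_bigr=> p _.
move: (f@_p) => c; rewrite mulr (bigD1 (psource p)) //= big1 ?addr0.
  by rewrite mulU pconcp1 eqxx mulr1.
by move=> i ip; rewrite mulU pconcp1 (negbTE ip).
Qed.

End Abstract.

Lemma pathmulA : associative pathmul.
Proof. exact: (abs_mulA pathE pathmul_suml pathmul_sumr pathmulUU). Qed.

Lemma pathmul1g : left_id pathone pathmul.
Proof. exact: (abs_mul1 pathE pathmul_suml pathmul_sumr pathmulUU). Qed.

Lemma pathmulg1 : right_id pathone pathmul.
Proof. exact: (abs_mulg1 pathE pathmul_suml pathmul_sumr pathmulUU). Qed.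

HB.instance Definition _ := GRing.Zmodule_isPzRing.Build A
  pathmulA pathmul1g pathmulg1 pathmulDl pathmulDr.

Lemma pathmulUZ p q (a c : k) : pathmulU p q (a * c) = a *: pathmulU p q c.
Proof.
rewrite /pathmulU; case: pconc => [r|]; last by rewrite scaler0.
apply/malgP=> s; rewrite -[LHS]/(mcoeff s _) (mcoeffU r (a * c) s).
by rewrite (mcoeffZ a << c *g r >> s) (mcoeffU r c s) mulrnAr.
Qed.

Lemma pathscaleAl (a : k) (f g : A) : a *: (f * g) = a *: f * g.
Proof.
have s := fsubset_refl (msupp g).
rewrite [RHS](pathmulw (msuppZ_le _ _) s) scaler_sumr; apply/eq_bigr=> p _.
rewrite scaler_sumr; apply/eq_bigr=> q _; rewrite -pathmulUZ mulrA.
by congr (pathmulU p q (_ * _)); exact/esym/mcoeffZ.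
Qed.

Lemma pathscaleAr (a : k) (f g : A) : a *: (f * g) = f * (a *: g).
Proof.
have s := fsubset_refl (msupp f).
rewrite [RHS](pathmulw s (msuppZ_le _ _)) scaler_sumr; apply/eq_bigr=> p _.
rewrite scaler_sumr; apply/eq_bigr=> q _; rewrite -pathmulUZ mulrCA.
by congr (pathmulU p q (_ * _)); exact/esym/mcoeffZ.
Qed.


End PathAlgebra.

(* A preadditive category.  The abelian group structure on hom-sets is carried by
   raw operations rather than by [zmodType], whose universe is tied to that of
   modules: functor categories could not be instances of this record. *)

Record preadd : Type := Preadd {
  ob :> Type;
  hom : ob -> ob -> Type;
  hzero : forall x y, hom x y;
  hadd : forall x y, hom x y -> hom x y -> hom x y;
  hopp : forall x y, hom x y -> hom x y;
  idm : forall x, hom x x;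
  comp : forall x y z, hom y z -> hom x y -> hom x z;
  haddA : forall x y, associative (@hadd x y);
  haddC : forall x y, commutative (@hadd x y);
  hadd0 : forall x y, left_id (@hzero x y) (@hadd x y);
  haddN : forall x y, left_inverse (@hzero x y) (@hopp x y) (@hadd x y);
  compA : forall x y z t (f : hom z t) (g : hom y z) (h : hom x y),
    comp f (comp g h) = comp (comp f g) h;
  comp1f : forall x y (f : hom x y), comp (idm y) f = f;
  compf1 : forall x y (f : hom x y), comp f (idm x) = f;
  compDl : forall x y z (f g : hom y z) (h : hom x y),
    comp (hadd f g) h = hadd (comp f h) (comp g h);
  compDr : forall x y z (f : hom y z) (g h : hom x y),
    comp f (hadd g h) = hadd (comp f g) (comp f h) }.

Arguments hom {p} x y.
Arguments hzero {p} x y.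
Arguments hadd {p x y} f g.
Arguments hopp {p x y} f.
Arguments idm {p} x.
Arguments comp {p x y z} f g.

Section InACategory.
Variable D : preadd.
Implicit Types X Y S : D.

Definition isom X Y : Prop :=
  exists (f : hom X Y) (g : hom Y X), comp f g = idm Y /\ comp g f = idm X.

Definition is_zero X : Prop := idm X = hzero X X.

Definition direct_sum X Y S : Prop :=
  exists (i1 : hom X S) (i2 : hom Y S) (p1 : hom S X) (p2 : hom S Y),
    [/\ comp p1 i1 = idm X, comp p2 i2 = idm Y,
        comp p1 i2 = hzero Y X, comp p2 i1 = hzero X Y
      & hadd (comp i1 p1) (comp i2 p2) = idm S].

Definition summand X S : Prop := exists Y, direct_sum X Y S.

Definition indecomposable S : Prop :=
  ~ is_zero S /\ forall X Y, direct_sum X Y S -> is_zero X \/ is_zero Y.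

(* The additive closure: the smallest class of objects containing [gen] and
   closed under isomorphisms, finite direct sums and direct summands. *)
Inductive add_closure (gen : D -> Prop) : D -> Prop :=
| AddGen X : gen X -> add_closure gen X
| AddIso X Y : isom X Y -> add_closure gen X -> add_closure gen Y
| AddZero X : is_zero X -> add_closure gen X
| AddSum X Y S : direct_sum X Y S ->
    add_closure gen X -> add_closure gen Y -> add_closure gen S
| AddSummand X S : summand X S -> add_closure gen S -> add_closure gen X.

End InACategory.

Record functor (B D : preadd) : Type := Functor {
  fobj :> B -> D;
  fmap : forall x y, hom x y -> hom (fobj x) (fobj y);
  fmap1 : forall x, fmap (idm x) = idm (fobj x);
  fmapM : forall x y z (f : hom y z) (g : hom x y),
    fmap (comp f g) = comp (fmap f) (fmap g) }.

Arguments fmap {B D} F {x y} f : rename.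

Definition additive_functor (B D : preadd) (F : functor B D) : Prop :=
  forall x y (f g : @hom B x y), fmap F (hadd f g) = hadd (fmap F f) (fmap F g).

Definition idF (B : preadd) : functor B B.
Proof. by exists (fun x => x) (fun x y f => f). Defined.

Definition compF (B D E : preadd) (F : functor D E) (G : functor B D) :
  functor B E.
Proof.
exists (fun x => F (G x)) (fun x y f => fmap F (fmap G f)).
- by move=> x; rewrite !fmap1.
- by move=> x y z f g; rewrite !fmapM.
Defined.

Record nattrans (B D : preadd) (F G : functor B D) : Type := NatTrans {
  ncomp :> forall x, hom (F x) (G x);
  nnat : forall x y (f : hom x y),
    comp (ncomp y) (fmap F f) = comp (fmap G f) (ncomp x) }.

Section FunctorCategory.
Variables B D : preadd.
Implicit Types F G H : functor B D.

Lemma nattransP F G (s t : nattrans F G) : (forall x, s x = t x) -> s = t.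
Proof.
case: s t => [s hs] [t ht] /= st; have {}st : s = t by apply: functional_extensionality_dep.
by case: t / st ht => ht; congr NatTrans; apply: Prop_irrelevance.
Qed.

Lemma comp0f (E : preadd) (x y z : E) (f : hom x y) : comp (hzero y z) f = hzero x z.
Proof.
set u := comp _ _; have : hadd u u = u by rewrite -compDl hadd0.
by move/(congr1 (hadd (hopp u))); rewrite haddA haddN hadd0.
Qed.

Lemma compf0 (E : preadd) (x y z : E) (f : hom y z) : comp f (hzero x y) = hzero x z.
Proof.
set u := comp _ _; have : hadd u u = u by rewrite -compDr hadd0.
by move/(congr1 (hadd (hopp u))); rewrite haddA haddN hadd0.
Qed.

Lemma hopp_uniq (E : preadd) (x y : E) (f g : hom x y) : hadd f g = hzero x y -> f = hopp g.
Proof.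
move=> fg; rewrite -[LHS]hadd0 -(haddN g) -haddA [hadd g f]haddC fg.
by rewrite haddC hadd0.
Qed.

Lemma compNf (E : preadd) (x y z : E) (g : hom y z) (f : hom x y) :
  comp (hopp g) f = hopp (comp g f).
Proof. by apply: hopp_uniq; rewrite -compDl haddN comp0f. Qed.

Lemma compfN (E : preadd) (x y z : E) (g : hom y z) (f : hom x y) :
  comp g (hopp f) = hopp (comp g f).
Proof. by apply: hopp_uniq; rewrite -compDr haddN compf0. Qed.

Definition nzero F G : nattrans F G.
Proof. by exists (fun x => hzero (F x) (G x)) => x y f; rewrite comp0f compf0. Defined.

Definition nadd F G (s t : nattrans F G) : nattrans F G.
Proof.
exists (fun x => hadd (s x) (t x)) => x y f.
by rewrite compDl compDr !nnat.
Defined.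

Definition nopp F G (s : nattrans F G) : nattrans F G.
Proof.
by exists (fun x => hopp (s x)) => x y f; rewrite compNf compfN nnat.
Defined.

Definition nid F : nattrans F F.
Proof. by exists (fun x => idm (F x)) => x y f; rewrite comp1f compf1. Defined.

Definition nvcomp F G H (s : nattrans G H) (t : nattrans F G) : nattrans F H.
Proof.
exists (fun x => comp (s x) (t x)) => x y f.
by rewrite -compA nnat compA nnat compA.
Defined.

Definition funcat : preadd.
Proof.
apply: (@Preadd (functor B D) (@nattrans B D) nzero nadd nopp nid nvcomp).
- by move=> F G s t u; apply: nattransP => x /=; rewrite haddA.
- by move=> F G s t; apply: nattransP => x /=; rewrite haddC.
- by move=> F G s; apply: nattransP => x /=; rewrite hadd0.
- by move=> F G s; apply: nattransP => x /=; rewrite haddN.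
- by move=> F G H K s t u; apply: nattransP => x /=; rewrite compA.
- by move=> F G s; apply: nattransP => x /=; rewrite comp1f.
- by move=> F G s; apply: nattransP => x /=; rewrite compf1.
- by move=> F G H s t u; apply: nattransP => x /=; rewrite compDl.
- by move=> F G H s t u; apply: nattransP => x /=; rewrite compDr.
Defined.

End FunctorCategory.

Record equivalence (B D : preadd) : Type := Equivalence {
  eqv_to : functor B D;
  eqv_from : functor D B;
  eqv_to_additive : additive_functor eqv_to;
  eqv_from_additive : additive_functor eqv_from;
  eqv_fromK : @isom (funcat B B) (compF eqv_from eqv_to) (idF B);
  eqv_toK : @isom (funcat D D) (compF eqv_to eqv_from) (idF D) }.

Section Modules.
Variable A : pzRingType.

Record fgmod : Type := FgMod {
  fgmod_sort :> lmodType A;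
  fgmodP : exists (r : nat) (g : 'I_r -> fgmod_sort),
    forall m, exists a : 'I_r -> A, m = \sum_(i < r) a i *: g i }.

Lemma linearP_ext (M N : lmodType A) (f g : {linear M -> N}) : f =1 g -> f = g.
Proof.
case: f g => [f cf] [g cg] /= fg; have {}fg : f = g by apply: functional_extensionality_dep.
case: g / fg cg => cg; congr GRing.Linear.Pack.
case: cf cg => [[a1] [b1]] [[a2] [b2]].
by congr GRing.Linear.Class; [congr GRing.isNmodMorphism.Axioms_
  | congr GRing.isScalable.Axioms_]; apply: Prop_irrelevance.
Qed.

Definition fgmod_cat : preadd.
Proof.
apply: (@Preadd fgmod (fun M N => {linear M -> N})
  (fun M N => \0 : {linear M -> N})
  (fun M N f g => f \+ g : {linear M -> N})
  (fun M N f => \- f : {linear M -> N})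
  (fun M => idfun : {linear M -> M})
  (fun M N P f g => f \o g : {linear M -> P})).
- by move=> M N f g h; apply: linearP_ext => x /=; rewrite addrA.
- by move=> M N f g; apply: linearP_ext => x /=; rewrite addrC.
- by move=> M N f; apply: linearP_ext => x /=; rewrite add0r.
- by move=> M N f; apply: linearP_ext => x /=; rewrite addNr.
- by move=> M N P Q f g h; apply: linearP_ext.
- by move=> M N f; apply: linearP_ext.
- by move=> M N f; apply: linearP_ext.
- by move=> M N P f g h; apply: linearP_ext.
- by move=> M N P f g h; apply: linearP_ext => x /=; rewrite linearD.
Defined.

Definition two_sided_ideal (I : A -> Prop) : Prop :=
  [/\ I 0, forall x y, I x -> I y -> I (x + y),
      forall a x, I x -> I (a * x) & forall a x, I x -> I (x * a)].

(* A-balanced biadditive maps I x M -> Z.  Such a map is represented by a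
   function on A x M whose values outside I x M are irrelevant. *)
Definition balanced (I : A -> Prop) (M : lmodType A) (Z : zmodType)
    (b : A -> M -> Z) : Prop :=
  [/\ forall x y m, I x -> I y -> b (x + y) m = b x m + b y m,
      forall x m m', I x -> b x (m + m') = b x m + b x m'
    & forall x a m, I x -> b (x * a) m = b x (a *: m)].

(* T, with t x m in the role of the pure tensors, is the tensor product of the
   right module I and the left module M over A. *)
Definition is_tensor (I : A -> Prop) (M : lmodType A) (T : zmodType)
    (t : A -> M -> T) : Prop :=
  balanced I t /\
  forall (Z : zmodType) (b : A -> M -> Z), balanced I b ->
    exists h : {additive T -> Z},
      (forall x m, I x -> h (t x m) = b x m) /\
      forall h' : {additive T -> Z},
        (forall x m, I x -> h' (t x m) = b x m) -> h' =1 h.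

(* F is isomorphic to the functor I (x)_A _ : each F M is a tensor product of I
   and M, whose left A-action is a (x (x) m) = (a x) (x) m, and F f is the map
   x (x) m |-> x (x) f m. *)
Definition dual_projection (I : A -> Prop) (F : functor fgmod_cat fgmod_cat)
    : Prop :=
  exists t : forall M : fgmod, A -> M -> (F M : fgmod),
    [/\ forall M, is_tensor I (t M),
        forall (M : fgmod) a x (m : M), I x -> t M (a * x) m = a *: t M x m
      & forall (M N : fgmod) (f : {linear M -> N}) x m, I x ->
          (fmap F (f : @hom fgmod_cat M N) : {linear _ -> _}) (t M x m)
            = t N x (f m)].

End Modules.

(* The 2-category P has one object, identified with the category C; its
   2-morphisms are all natural transformations, so that its category of
   1-morphisms is the full subcategory [one_morphism] of [funcat C C]. *)

Section Multisemigroup.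
Variables (A : pzRingType) (C : preadd) (E : equivalence (fgmod_cat A) C).

Definition generator (F : functor C C) : Prop :=
  @isom (funcat C C) F (idF C) \/
  exists (I : A -> Prop) (D : functor (fgmod_cat A) (fgmod_cat A)),
    [/\ two_sided_ideal I, dual_projection I D
      & @isom (funcat C C) F (compF (eqv_to E) (compF D (eqv_from E)))].

Definition one_morphism (F : functor C C) : Prop :=
  @add_closure (funcat C C) generator F.

(* Since 1-morphisms are closed under direct summands, indecomposability in P
   and in [funcat C C] agree. *)
Definition is_indec_class (c : functor C C -> Prop) : Prop :=
  exists F, [/\ one_morphism F, @indecomposable (funcat C C) F
              & c = @isom (funcat C C) F].

(* [None] is the external zero element. *)
Definition msemigroup : Type := option {c : functor C C -> Prop | is_indec_class c}.

(* [mstar x y z] means that z belongs to the set x * y. *)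
Definition mstar (x y z : msemigroup) : Prop :=
  match x, y with
  | Some c, Some d =>
      exists F G : functor C C, [/\ sval c F, sval d G &
        (is_zero (compF F G : funcat C C) /\ z = None) \/
        (~ is_zero (compF F G : funcat C C) /\
         exists h H, [/\ z = Some h, sval h H
                       & @summand (funcat C C) H (compF F G)])]
  | _, _ => z = None
  end.

End Multisemigroup.

Definition is_monoid (S : Type) (op : S -> S -> S -> Prop) : Prop :=
  exists (mul : S -> S -> S) (one : S),
    [/\ forall x y z, op x y z <-> z = mul x y,
        associative mul, left_id one mul & right_id one mul].

(* Main.v *)
From HB Require Import structures.
Require Import Defs.
From mathcomp Require Import all_boot all_order all_algebra.
From mathcomp Require Import finmap boolp.
From mathcomp.multinomials Require Import monalg.
Import Defs.

(* In a tree there is at most one path between two vertices, so two-sided ideals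
   of A are the spans of the sets X of paths closed under extension, and the
   bimodule X decomposes according to the connected components of X under the
   extension relation. Bimodule endomorphisms of a connected ideal are scalars;
   hence so are the endomorphisms of its dual projection functor, and Gaussian
   elimination on a decomposition of the identity shows that the indecomposable
   1-morphisms are the functors attached to connected ideals.
   Since Dp_X Dp_Y = Dp_(XY), all that remains is that XY is connected or zero
   when X and Y are connected. If u is a sink or source whose trivial path is
   not in X, then X lies on one branch of the tree at u. Hence, on the walk
   joining two paths of XY, the trivial path at every vertex where the
   orientation turns belongs both to X and to Y, and so to XY; by admissibility
   the walk is directed between such vertices, so the two paths are connected
   inside XY. *)

Set Implicit Arguments.
Unset Strict Implicit.
Unset Printing Implicit Defensive.
Import GRing.Theory.
Local Open Scope ring_scope.

(** * Preadditive categories *)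

(** The category [C] is given only as a preadditive category: its definition supplies neither direct
    sums, nor a zero object, nor uniqueness of decompositions. Membership in an additive closure is
    therefore used only through the statement that an identity is a finite sum of composites through
    given objects, and split idempotents are carried from modules to [C] and then to its
    endofunctors. The identification of Dp_X Dp_Y with Dp_(XY) amounts to injectivity of I ⊗ J ->
    IJ, in general a flatness question. In a tree it can be made explicit: the vertices through
    which a path from i to l factors form a chain, so two factorizations differ by a path that
    slides across the tensor sign. Tensor products are never constructed; those that occur come from
    given functors, the identity, composites and split idempotents. Once a path is coded by its two
    ends, ideals are Boolean relations on vertices and their product is composition of relations.
    The monoid laws are proved there, with the empty relation standing for the external zero. *)

Section Preadditive.
Variable D : preadd.
Implicit Types X Y Z S T : D.

Lemma haddf0 X Y (f : hom X Y) : hadd f (hzero X Y) = f.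
Proof. by rewrite haddC hadd0. Qed.

Lemma haddfN X Y (f : hom X Y) : hadd f (hopp f) = hzero X Y.
Proof. by rewrite haddC haddN. Qed.

Lemma hadd_self0 X Y (f : hom X Y) : hadd f f = f -> f = hzero X Y.
Proof. by move/(congr1 (hadd (hopp f))); rewrite haddA haddN hadd0. Qed.

Lemma isom_refl X : isom X X.
Proof. by exists (idm X), (idm X); rewrite comp1f. Qed.

Lemma isom_sym X Y : isom X Y -> isom Y X.
Proof. by case=> f [g [fg gf]]; exists g, f. Qed.

Lemma isom_trans X Y Z : isom X Y -> isom Y Z -> isom X Z.
Proof.
move=> [f [g [fg gf]]] [f' [g' [fg' gf']]]; exists (comp f' f), (comp g g').
split; first by rewrite -compA (compA f) fg comp1f.
by rewrite -compA (compA g') gf' comp1f.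
Qed.

Lemma isom_classP X Y : (@isom D X = @isom D Y) <-> isom X Y.
Proof.
split=> [->|XY]; first exact: isom_refl.
apply/funext => Z; apply/propext; split; last exact: isom_trans.
exact/isom_trans/isom_sym.
Qed.

Definition invertible X Y (f : hom X Y) : Prop :=
  exists g : hom Y X, comp f g = idm Y /\ comp g f = idm X.

Lemma is_zero_hom X Y (f : hom X Y) : is_zero X -> f = hzero X Y.
Proof. by move=> X0; rewrite -[f]compf1 X0 compf0. Qed.

Lemma is_zero_isom X Y : isom X Y -> is_zero X -> is_zero Y.
Proof.
move=> [f [g [fg _]]] X0; red; rewrite -fg (is_zero_hom f X0); exact: comp0f.
Qed.

(** The endomorphism ring is a division ring. Being stronger than indecomposability, this gives the
    clean dichotomy on which elimination relies. *)
Definition brick X : Prop :=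
  ~ is_zero X /\ forall f : hom X X, f = hzero X X \/ invertible f.

Lemma invertible_idem X (f : hom X X) : invertible f -> comp f f = f -> f = idm X.
Proof. by move=> [g [_ gf]] ff; rewrite -[f]comp1f -gf -compA ff. Qed.

Lemma brick_idem X (f : hom X X) : brick X -> comp f f = f ->
  f = hzero X X \/ f = idm X.
Proof.
by move=> [_ /(_ f) [->|fi] ff]; [left | right; exact: invertible_idem].
Qed.

(** The idempotent [comp i p] is 0 or 1, and if it is 0 then [idm Y], which equals p (i p) i,
    vanishes. *)
Lemma brick_retract X Y (i : hom Y X) (p : hom X Y) : brick X ->
  comp p i = idm Y -> is_zero Y \/ comp i p = idm X.
Proof.
move=> bX pi; have [|ip|ip] := @brick_idem X (comp i p) bX.
- by rewrite -compA (compA p) pi comp1f.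
- left; red; have -> : idm Y = comp p (comp (comp i p) i) by rewrite -compA pi compf1.
  by rewrite ip comp0f compf0.
- by right.
Qed.

Lemma brick_indecomposable X : brick X -> indecomposable X.
Proof.
move=> bX; split; first by case: bX.
move=> Y Z [i1 [i2 [p1 [p2 [E1 E2 E12 E21 _]]]]].
have [Y0|ip] := brick_retract bX E1; first by left.
right; red.
by rewrite -E2 -[i2]comp1f -ip -compA E12 compf0 compf0.
Qed.

Lemma brick_summand X Y : brick X -> ~ is_zero Y -> summand Y X -> isom Y X.
Proof.
move=> bX Y0 [Z [i1 [i2 [p1 [p2 [E1 _ _ _ _]]]]]].
by have [//|ip] := brick_retract bX E1; exists i1, p1.
Qed.

Lemma brick_isom X Y : isom X Y -> brick X -> brick Y.
Proof.
move=> XY [X0 bX]; split.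
  by move=> /is_zero_isom Y0; apply/X0/Y0/isom_sym.
case: XY => u [v [uv vu]] f.
have fE : f = comp u (comp (comp v (comp f u)) v).
  by rewrite -!compA uv compf1 compA uv comp1f.
case: (bX (comp v (comp f u))) => [f0|[g [fg gf]]].
  by left; rewrite fE f0 comp0f compf0.
right; exists (comp u (comp g v)); rewrite fE; split.
  rewrite -!compA (compA v u) vu comp1f (compA f) (compA v) (compA (comp v _)).
  by rewrite fg comp1f.
rewrite -!compA (compA v u) vu comp1f.
by rewrite (compA f) (compA v) (compA g) gf comp1f.
Qed.

Definition split_idempotents : Prop := forall X (f : hom X X), comp f f = f ->
  exists Y (i : hom Y X) (p : hom X Y), comp p i = idm Y /\ comp i p = f.

(** Splitting the complementary idempotent 1 - ip produces the missing summand Z of X.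
    Indecomposability forces Z to be zero, and then ip = 1. *)
Lemma split_retract_indec X Y (i : hom Y X) (p : hom X Y) : split_idempotents ->
  indecomposable X -> comp p i = idm Y -> ~ is_zero Y -> isom Y X.
Proof.
move=> sp [_ iX] pi Y0; pose f := hadd (idm X) (hopp (comp i p)).
have fip : comp f (comp i p) = hzero X X.
  by rewrite compDl comp1f compNf -compA (compA p) pi comp1f haddfN.
have pf : comp p f = hzero X Y.
  by rewrite compDr compf1 compfN compA pi comp1f haddfN.
have fi : comp f i = hzero Y X.
  by rewrite compDl comp1f compNf -compA pi compf1 haddfN.
have ff : comp f f = f.
  rewrite {2}/f compDr compf1 compfN fip -[RHS]haddf0; congr hadd.
  by rewrite -[LHS]hadd0 haddfN.
have [Z [j [q [qj jq]]]] := sp X f ff.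
have qE : q = comp q f by rewrite -jq compA qj comp1f.
have jE : j = comp f j by rewrite -jq -compA qj compf1.
have sumE : hadd (comp i p) (comp j q) = idm X.
  by rewrite jq haddC -haddA haddN haddf0.
have [] := iX Y Z; last 1 first.
- move=> Z0; exists i, p; split=> //; rewrite -sumE (is_zero_hom j Z0).
  by rewrite comp0f haddf0.
- exists i, j, p, q; split=> //; first by rewrite jE compA pf comp0f.
  by rewrite qE -compA fi compf0.
- by [].
Qed.

(** The two-sided ideal of morphisms generated by the identities of objects of [G]. For an identity
    it expresses being a summand of a finite sum of such objects without forming that sum. *)
Inductive factors (G : D -> Prop) X Y : hom X Y -> Prop :=
| Factors0 : factors G (hzero X Y)
| FactorsS Z (a : hom Z Y) (b : hom X Z) f :
    G Z -> factors G f -> factors G (hadd (comp a b) f).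

Lemma factorsD G X Y (f g : hom X Y) : factors G f -> factors G g ->
  factors G (hadd f g).
Proof.
move=> fF gF; elim: fF => [|Z a b {}f GZ _ IH]; first by rewrite hadd0.
by rewrite -haddA; apply: FactorsS.
Qed.

Lemma factorsM G X Y X' Y' (g : hom Y Y') (f : hom X Y) (h : hom X' X) :
  factors G f -> factors G (comp g (comp f h)).
Proof.
elim=> [|Z a b {}f GZ _ IH]; first by rewrite comp0f compf0; exact: Factors0.
rewrite compDl compDr -compA compA; exact: FactorsS.
Qed.

(* Gaussian elimination on 1 = a_1 b_1 + ... + a_m b_m: either b_1 a_1 is
   invertible and Z_1 is a retract, or b_1 a_1 = 0 and multiplying by
   1 + a_1 b_1 kills the first term. *)
Lemma factors_retract G X : (forall Z, G Z -> brick Z) -> factors G (idm X) ->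
  ~ is_zero X ->
  exists Z (i : hom Z X) (p : hom X Z), G Z /\ comp p i = idm Z.
Proof.
(* The statement is generalized to an [f] with a left inverse [g]: dropping a term keeps the rest of
   the sum but changes the left inverse. *)
move=> Gbrick + X0; suff H (Y : D) (f : hom X Y) : factors G f ->
    forall g : hom Y X, comp g f = idm X ->
    exists Z (i : hom Z X) (p : hom X Z), G Z /\ comp p i = idm Z.
  by move/H; apply; exact: comp1f.
elim=> [|Z a b {}f GZ _ IH] g.
  by rewrite compf0 => /esym.
rewrite compDr compA => E.
have [_ /(_ (comp b (comp g a))) [ba0|[c [_ cba]]]] := Gbrick _ GZ.
  have bE : comp b (comp g f) = b.
    by rewrite -{2}[b]compf1 -E compDr (compA b (comp g a)) ba0 comp0f hadd0.
  apply: (IH (comp (hadd (idm X) (comp (comp g a) b)) g)).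
  by rewrite -compA compDl comp1f -(compA (comp g a)) bE haddC.
by exists Z, (comp g a), (comp c b); rewrite -compA.
Qed.

Lemma indec_factors G X : split_idempotents -> (forall Z, G Z -> brick Z) ->
  indecomposable X -> factors G (idm X) -> exists2 Z, G Z & isom Z X.
Proof.
move=> sp Gbrick iX /(factors_retract Gbrick)[|Z [i [p [GZ pi]]]].
  by case: iX.
exists Z => //; apply: split_retract_indec pi _ => //.
by case: (Gbrick _ GZ).
Qed.

(** Every clause of [add_closure] writes the new identity as a sum of composites through the old
    identities, and [factors] is an ideal. *)
Lemma add_closure_factors (gen G : D -> Prop) X :
  (forall Y, gen Y -> factors G (idm Y)) -> add_closure gen X -> factors G (idm X).
Proof.
move=> genG; elim=> {X} [X|X Y [f [g [fg _]]] _ IH|X|X Y S|X S].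
- exact: genG.
- by rewrite -fg -[g]comp1f; exact: factorsM.
- by move=> ->; exact: Factors0.
- move=> [i1 [i2 [p1 [p2 [_ _ _ _ <-]]]]] _ IH1 _ IH2.
  by apply: factorsD; rewrite -[X in comp _ X]comp1f; exact: factorsM.
- by move=> [Y [i1 [i2 [p1 [p2 [<- _ _ _ _]]]]]] _ IH; rewrite -[i1]comp1f; exact: factorsM.
Qed.

End Preadditive.

Section Invertible.
Variable D : preadd.

Lemma invertibleM (X Y Z : D) (f : hom Y Z) (g : hom X Y) :
  invertible f -> invertible g -> invertible (comp f g).
Proof.
move=> [f' [ff' f'f]] [g' [gg' g'g]]; exists (comp g' f'); split.
  by rewrite -compA (compA g) gg' comp1f.
by rewrite -compA (compA f') f'f comp1f.
Qed.

Lemma invertible_fmap (B : preadd) (F : functor B D) (X Y : B) (f : hom X Y) :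
  invertible f -> invertible (fmap F f).
Proof. by move=> [g [fg gf]]; exists (fmap F g); rewrite -!fmapM fg gf !fmap1. Qed.

End Invertible.

(** * Pointwise constructions in functor categories *)

Section FunctorCategories.
Variables B D : preadd.
Implicit Types F G : functor B D.

Lemma nat_invertible F G (s : nattrans F G) :
  (forall x, invertible (s x)) -> @invertible (funcat B D) F G s.
Proof.
move=> si; pose t x : hom (G x) (F x) := sval (cid (si x)).
have st x : comp (s x) (t x) = idm _ by rewrite /t; case: cid => ? [].
have ts x : comp (t x) (s x) = idm _ by rewrite /t; case: cid => ? [].
have tn x y (f : hom x y) : comp (t y) (fmap G f) = comp (fmap F f) (t x).
  rewrite -[fmap G f]compf1 -st (compA (fmap G f)) -nnat.
  by rewrite !compA ts comp1f.
by exists (NatTrans tn); split; apply: nattransP => x /=.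
Qed.

Lemma nat_isom F G (s : nattrans F G) :
  (forall x, invertible (s x)) -> @isom (funcat B D) F G.
Proof. by move/nat_invertible => [t st]; exists s, t. Qed.

Lemma nat_invertibleE F G (s : nattrans F G) x :
  @invertible (funcat B D) F G s -> invertible (s x).
Proof.
case=> t [st ts]; exists (t x).
by split; [move/(congr1 (fun u : nattrans _ _ => u x)): st
  | move/(congr1 (fun u : nattrans _ _ => u x)): ts].
Qed.

Lemma nattrans_eq F G (s t : @hom (funcat B D) F G) x :
  s = t -> (s : nattrans F G) x = (t : nattrans F G) x.
Proof. by move->. Qed.

Lemma is_zero_funcatE F x : @is_zero (funcat B D) F -> is_zero (F x).
Proof. exact: (@nattrans_eq F F (nid F) (nzero F F) x). Qed.

(** A splitting [Y x], [i x], [p x] is chosen at each object. The maps p (F g) i make [Y] a functor,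
    because i p = f and f is natural. *)
Lemma split_funcat : split_idempotents D -> split_idempotents (funcat B D).
Proof.
move=> sp F f ff; have ffx x : comp (f x) (f x) = f x by exact: (nattrans_eq x ff).
have ex x : exists t : {Y : D & (hom Y (F x) * hom (F x) Y)%type},
    comp (projT2 t).2 (projT2 t).1 = idm _ /\ comp (projT2 t).1 (projT2 t).2 = f x.
  by have [Y [i [p [pi ip]]]] := sp _ _ (ffx x); exists (existT _ Y (i, p)).
pose Y x := projT1 (sval (cid (ex x))).
pose i x : hom (Y x) (F x) := (projT2 (sval (cid (ex x)))).1.
pose p x : hom (F x) (Y x) := (projT2 (sval (cid (ex x)))).2.
have pi x : comp (p x) (i x) = idm (Y x) by have [] := svalP (cid (ex x)).
have ip x : comp (i x) (p x) = f x by have [] := svalP (cid (ex x)).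
have fi x : comp (f x) (i x) = i x by rewrite -ip -compA pi compf1.
have pf x : comp (p x) (f x) = p x by rewrite -ip compA pi comp1f.
pose m x y (g : hom x y) : hom (Y x) (Y y) := comp (p y) (comp (fmap F g) (i x)).
have m1 x : m x x (idm x) = idm (Y x) by rewrite /m fmap1 comp1f pi.
have mM x y z (g : hom y z) (h : hom x y) : m x z (comp g h) = comp (m y z g) (m x y h).
  rewrite /m fmapM -!compA (compA (i y)) ip (compA (f y)) nnat.
  by rewrite -(compA (fmap F h)) fi.
pose H : functor B D := Functor m1 mM.
have iN x y (g : hom x y) : comp (i y) (fmap H g) = comp (fmap F g) (i x).
  by rewrite /= /m compA ip compA nnat -compA fi.
have pN x y (g : hom x y) : comp (p y) (fmap F g) = comp (fmap H g) (p x).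
  by rewrite /= /m -!compA ip -nnat compA pf.
exists H, (@NatTrans _ _ H F i iN), (@NatTrans _ _ F H p pN).
by split; apply: nattransP => x /=.
Qed.

End FunctorCategories.

Lemma comp_isom (B D E : preadd) (F F' : functor D E) (G G' : functor B D) :
  @isom (funcat _ _) F F' -> @isom (funcat _ _) G G' ->
  @isom (funcat _ _) (compF F G) (compF F' G').
Proof.
move=> [s [s' [ss' s's]]] [t [t' [tt' t't]]].
have si x : invertible (s x) by apply: nat_invertibleE; exists s'.
have ti x : invertible (t x) by apply: nat_invertibleE; exists t'.
pose u x : hom (F (G x)) (F' (G' x)) := comp (s (G' x)) (fmap F (t x)).
have uN x y (f : hom x y) : comp (u y) (fmap (compF F G) f) = comp (fmap (compF F' G') f) (u x).
  by rewrite /u /= -compA -fmapM (nnat t) fmapM compA (nnat s) compA.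
apply: (@nat_isom _ _ _ _ (@NatTrans _ _ (compF F G) (compF F' G') u uN)) => x /=.
exact/invertibleM/invertible_fmap.
Qed.

(** * Transport of endofunctors along an equivalence *)

Section Conjugation.
Variables (B D : preadd) (K : functor B D) (L : functor D B).

Lemma conj_nat (F G : functor B B) (s : nattrans F G) x y (f : hom x y) :
  comp (fmap K (s (L y))) (fmap (compF K (compF F L)) f) =
  comp (fmap (compF K (compF G L)) f) (fmap K (s (L x))).
Proof. by rewrite /= -!fmapM nnat. Qed.

Definition conj_trans (F G : functor B B) (s : nattrans F G) :
    nattrans (compF K (compF F L)) (compF K (compF G L)) :=
  NatTrans (F := compF K (compF F L)) (G := compF K (compF G L)) (conj_nat s).

(** Transport F |-> K F L is made a functor between functor categories, so that isomorphisms, zero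
    objects and factorizations are carried along by functoriality. *)
Definition conj_functor : functor (funcat B B) (funcat D D).
Proof.
exists (fun F : funcat B B => compF K (compF F L) : funcat D D) conj_trans.
- by move=> F; apply: nattransP => x /=; rewrite fmap1.
- by move=> F G H s t; apply: nattransP => x /=; rewrite fmapM.
Defined.

Lemma fmap0 (F : functor B D) x y : additive_functor F -> fmap F (hzero x y) = hzero _ _.
Proof. by move=> aF; apply: hadd_self0; rewrite -aF hadd0. Qed.

Lemma conj_additive : additive_functor K -> additive_functor conj_functor.
Proof. by move=> aK F G s t; apply: nattransP => x /=; rewrite aK. Qed.

End Conjugation.

Lemma conjK (B D : preadd) (K : functor B D) (L : functor D B)
    (b : nattrans (compF K L) (idF D)) (F : functor D D) x y (f : hom x y) :
  comp (comp (b (F y)) (fmap (compF K L) (fmap F (b y))))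
    (fmap (conj_functor K L (conj_functor L K F) : functor D D) f) =
  comp (fmap F f) (comp (b (F x)) (fmap (compF K L) (fmap F (b x)))).
Proof.
have E := nnat b f; have E' := nnat b (fmap F f); rewrite /= in E E'.
rewrite /= [RHS]compA -E' -!compA -!fmapM E.
by rewrite !fmapM.
Qed.

Section ConjugationByEquivalence.
Variables (B D : preadd) (K : functor B D) (L : functor D B).
Hypotheses (aK : additive_functor K) (aL : additive_functor L).
Hypothesis KL : @isom (funcat D D) (compF K L) (idF D).
Hypothesis LK : @isom (funcat B B) (compF L K) (idF B).

(** Two uses of [b] give isomorphisms [c x] from K L F K L x to F x that intertwine K L s K L with
    s. Hence vanishing or invertibility of L s K passes back to s. *)
Let reflect (F : functor D D) (s : @hom (funcat D D) F F) :
  fmap (conj_functor L K) s = hzero _ _ \/ invertible (fmap (conj_functor L K) s) ->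
  s = hzero _ _ \/ invertible s.
Proof.
have [b [b' [bb' b'b]]] := KL.
have bi x : invertible (b x) by apply: nat_invertibleE; exists b'.
pose c x : hom (K (L (F (K (L x))))) (F x) := comp (b (F x)) (fmap K (fmap L (fmap F (b x)))).
have ci x : invertible (c x).
  apply: invertibleM; first exact: (bi (F x)).
  by apply/invertible_fmap/invertible_fmap/invertible_fmap; exact: (bi x).
have E x : comp (c x) (fmap K (fmap L (s (K (L x))))) = comp (s x) (c x).
  have E1 := nnat b (s x); have E2 := nnat s (b x); rewrite /= in E1 E2.
  by rewrite /c -compA -!fmapM -E2 !fmapM !compA E1.
case=> [s0|si]; [left|right].
  apply: nattransP => x; have [c' [cc' _]] := ci x.
  have : fmap L (s (K (L x))) = hzero _ _ := nattrans_eq (L x) s0.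
  move: (E x) => /[swap] ->; rewrite fmap0 // compf0 => /(congr1 (comp^~ c')).
  by rewrite -compA cc' compf1 comp0f => <-.
apply: nat_invertible => x; have [c' [cc' c'c]] := ci x.
rewrite -[s x]compf1 -cc' compA -E; apply: invertibleM; last by exists (c x).
apply: invertibleM => //; apply: invertible_fmap.
exact: (nat_invertibleE (L x) si).
Qed.

(** Transporting K F L back gives L K F L K, which is isomorphic to F and so a brick. The dichotomy
    for its endomorphisms then descends by [reflect]. *)
Lemma conj_brick (F : functor B B) :
  @brick (funcat B B) F -> @brick (funcat D D) (conj_functor K L F).
Proof.
have [a [a' [aa' a'a]]] := LK.
have ai x : invertible (a x) by apply: nat_invertibleE; exists a'.
pose c x : hom (L (K (F (L (K x))))) (F x) := comp (a (F x)) (fmap L (fmap K (fmap F (a x)))).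
have ci x : invertible (c x).
  apply: invertibleM; first exact: (ai (F x)).
  by apply/invertible_fmap/invertible_fmap/invertible_fmap; exact: (ai x).
pose F' := conj_functor L K (conj_functor K L F) : functor B B.
have cN x y (f : hom x y) : comp (c y) (fmap F' f) = comp (fmap F f) (c x) := conjK a F f.
have iF : @isom (funcat B B) F F'.
  exact/isom_sym/(@nat_isom _ _ _ _ (@NatTrans _ _ F' F c cN)).
move=> /(brick_isom iF) [F0 bF]; split=> [K0|s]; last by apply: reflect; exact: bF.
apply: F0; red; rewrite -[idm _]/(idm (conj_functor L K (conj_functor K L F))).
rewrite -fmap1 K0; apply: fmap0; exact: conj_additive.
Qed.

Lemma conj_isom F G : @isom (funcat B B) F G ->
  @isom (funcat D D) (conj_functor K L F) (conj_functor K L G).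
Proof.
move=> [s [t [st ts]]].
exists (fmap (conj_functor K L) s), (fmap (conj_functor K L) t).
by rewrite -!fmapM st ts !fmap1.
Qed.

Lemma conj_factors G (G' : functor D D -> Prop) F F' (s : @hom (funcat B B) F F') :
  (forall H, G H -> G' (conj_functor K L H)) -> @factors (funcat B B) G F F' s ->
  @factors (funcat D D) G' _ _ (fmap (conj_functor K L) s).
Proof.
move=> GG'; elim=> [|Z p q {}s GZ _ IH].
  by rewrite fmap0; [exact: Factors0 | exact: conj_additive].
rewrite conj_additive // fmapM; apply: (@FactorsS (funcat D D)) => //; exact: GG'.
Qed.

(** The inner L K in K F L K G L is cancelled by the isomorphism with the identity. *)
Lemma conj_comp F G : @isom (funcat D D)
  (compF (conj_functor K L F : functor D D) (conj_functor K L G : functor D D))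
  (conj_functor K L (compF F G)).
Proof.
have [a [a' [aa' a'a]]] := LK.
have ai x : invertible (a x) by apply: nat_invertibleE; exists a'.
pose c x : hom (K (F (L (K (G (L x)))))) (K (F (G (L x)))) := fmap K (fmap F (a (G (L x)))).
have cN x y (f : hom x y) : comp (c y) (fmap K (fmap F (fmap L (fmap K (fmap G (fmap L f)))))) =
    comp (fmap K (fmap F (fmap G (fmap L f)))) (c x).
  by rewrite /c -!fmapM; congr (fmap K (fmap F _)); exact: (nnat a (fmap G (fmap L f))).
pose FG := compF (conj_functor K L F : functor D D) (conj_functor K L G : functor D D).
apply: (@nat_isom _ _ _ _ (@NatTrans _ _ FG (conj_functor K L (compF F G)) c cN)) => x.
exact: (invertible_fmap K (invertible_fmap F (ai (G (L x))))).
Qed.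

Lemma conj_id : @isom (funcat D D) (idF D) (conj_functor K L (idF B)).
Proof.
have [b [b' [bb' b'b]]] := KL; apply: isom_sym.
exists (@NatTrans _ _ (conj_functor K L (idF B)) (idF D) b (@nnat _ _ _ _ b)).
exists (@NatTrans _ _ (idF D) (conj_functor K L (idF B)) b' (@nnat _ _ _ _ b')).
by split; apply: nattransP => x; [exact: nattrans_eq bb' | exact: nattrans_eq b'b].
Qed.

Lemma split_equivalence : split_idempotents B -> split_idempotents D.
Proof.
have [b [b' [bb' b'b]]] := KL.
move=> sp X f ff; have [|Y [i [p [pi ip]]]] := sp _ (fmap L f).
  by rewrite -fmapM ff.
have Eb : comp (b X) (b' X) = idm X := nattrans_eq X bb'.
have Eb' : comp (b' X) (b X) = idm (K (L X)) := nattrans_eq X b'b.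
exists (K Y), (comp (b X) (fmap K i)), (comp (fmap K p) (b' X)); split.
  by rewrite -compA (compA (b' X)) Eb' comp1f -fmapM pi fmap1.
rewrite -compA (compA (fmap K i)) -fmapM ip compA.
have bN : comp (b X) (fmap K (fmap L f)) = comp f (b X) := nnat b f.
by rewrite bN -compA Eb compf1.
Qed.

End ConjugationByEquivalence.

Lemma factors_isom (D : preadd) (G : D -> Prop) (X Y : D) :
  isom X Y -> factors G (idm X) -> factors G (idm Y).
Proof. by move=> [f [g [fg _]]] GX; rewrite -fg -[g]comp1f; exact: factorsM. Qed.

(** A summand comes with a complement, so a zero object is required here; it is obtained by
    splitting the idempotent 0. *)
Lemma summand_refl (D : preadd) (X : D) : split_idempotents D -> summand X X.
Proof.
move=> sp; have [|Y [i [p [pi ip]]]] := sp X (hzero X X); first exact: comp0f.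
exists Y, (idm X), i, (idm X), p; split=> //.
- exact: comp1f.
- by rewrite comp1f -[i]compf1 -pi compA ip comp0f.
- by rewrite compf1 -[p]comp1f -pi -compA ip compf0.
- by rewrite comp1f ip haddf0.
Qed.

(** * Dual projection functors *)

Section FixedSubmodule.
Variables (A : pzRingType) (M : lmodType A) (f : {linear M -> M}).

(** For an idempotent the fixed points are the image. Described by an equation, the image becomes a
    Boolean predicate, as the subtype structures require. *)
Definition fixed_pred : {pred M} := [pred x | f x == x].

Fact fixed_pred_closed : submod_closed fixed_pred.
Proof.
split=> [|a x y]; rewrite !inE ?linear0 // => /eqP fx /eqP fy.
by rewrite linearP fx fy.
Qed.
HB.instance Definition _ := GRing.isSubmodClosed.Build A M fixed_pred fixed_pred_closed.

Record fixed_mod : predArgType := FixedMod { fixed_val : M; _ : fixed_val \in fixed_pred }.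
HB.instance Definition _ := [isSub for fixed_val].
HB.instance Definition _ := [Choice of fixed_mod by <:].
HB.instance Definition _ := [SubChoice_isSubLmodule of fixed_mod by <:].
End FixedSubmodule.

Section Modules.
Variable A : pzRingType.

Definition pack_linear (M N : lmodType A) (f : M -> N) (fL : linear f) : {linear M -> N} :=
  HB.pack f (GRing.isLinear.Build A M N *:%R f fL).

Definition pack_additive (M N : zmodType) (f : M -> N) (fB : zmod_morphism f) :
    {additive M -> N} :=
  HB.pack f (GRing.isZmodMorphism.Build M N f fB).

Definition hom_lin (M N : fgmod A) (f : @hom (fgmod_cat A) M N) : {linear M -> N} := f.

Lemma split_fgmod : split_idempotents (fgmod_cat A).
Proof.
move=> M f ff; pose N := fixed_mod (hom_lin f).
have fK x : hom_lin f (hom_lin f x) = hom_lin f x.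
  exact: (congr1 (fun u : {linear M -> M} => u x) ff).
have fP x : hom_lin f x \in fixed_pred (hom_lin f) by rewrite inE fK.
pose p x : N := FixedMod (fP x).
have pL : linear p by move=> a x y; apply: val_inj; rewrite /= linearP.
have vL : linear (val : N -> M) by move=> a x y; rewrite linearP.
have fgN : exists (r : nat) (g : 'I_r -> N),
    forall m, exists a : 'I_r -> A, m = \sum_(i < r) a i *: g i.
  have [r [g gM]] := fgmodP M; exists r, (fun i => p (g i)) => m.
  have [a mE] := gM (val m); exists a.
  have -> : m = pack_linear pL (val m).
    by apply: val_inj => /=; move: (valP m) => /eqP.
  by rewrite mE linear_sum; apply: eq_bigr => i _; rewrite linearZ.
exists (FgMod fgN), (pack_linear vL), (pack_linear pL).
split; apply: linearP_ext => x //=.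
by apply: val_inj => /=; move: (valP x) => /eqP.
Qed.

Fact regular_fg : exists (r : nat) (g : 'I_r -> A^o),
    forall m : A^o, exists a : 'I_r -> A, m = \sum_(i < r) a i *: g i.
Proof.
by exists 1%N, (fun=> 1) => m; exists (fun=> m); rewrite big_ord1 /GRing.scale /= mulr1.
Qed.
Definition regular_mod : fgmod A := FgMod regular_fg.

(** * Calculus of tensor products from their universal property *)

Section Tensor.
Variables (I : A -> Prop) (M : lmodType A) (T : zmodType) (t : A -> M -> T).
Hypothesis tT : is_tensor I t.

Lemma tensorDl x y m : I x -> I y -> t (x + y) m = t x m + t y m.
Proof. by case: tT => -[+ _ _] _; apply. Qed.

Lemma tensorDr x m m' : I x -> t x (m + m') = t x m + t x m'.
Proof. by case: tT => -[_ + _] _; apply. Qed.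

Lemma tensorA x a m : I x -> t (x * a) m = t x (a *: m).
Proof. by case: tT => -[_ _ +] _; apply. Qed.

Lemma tensor0r x : I x -> t x 0 = 0.
Proof. by move=> Ix; apply: (addrI (t x 0)); rewrite -tensorDr // !addr0. Qed.

Lemma tensor0l m : I 0 -> t 0 m = 0.
Proof. by move=> I0; apply: (addrI (t 0 m)); rewrite -tensorDl // !addr0. Qed.

Lemma tensor_suml (S : Type) (r : seq S) (f : S -> A) m : two_sided_ideal I ->
  (forall u, I (f u)) -> t (\sum_(u <- r) f u) m = \sum_(u <- r) t (f u) m.
Proof.
move=> [I0 ID _ _] If; elim: r => [|u r IH]; first by rewrite !big_nil tensor0l.
by rewrite !big_cons tensorDl ?IH //; elim/big_ind: _.
Qed.

Lemma tensor_sumr (S : Type) (r : seq S) (f : S -> M) x : I x ->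
  t x (\sum_(u <- r) f u) = \sum_(u <- r) t x (f u).
Proof.
move=> Ix; elim: r => [|u r IH]; first by rewrite !big_nil tensor0r.
by rewrite !big_cons tensorDr // IH.
Qed.

Lemma tensor_lift (Z : zmodType) (b : A -> M -> Z) : balanced I b ->
  exists h : {additive T -> Z}, forall x m, I x -> h (t x m) = b x m.
Proof. by case: tT => _ H /H[h [hE _]]; exists h. Qed.

Lemma balanced_additive (Z : zmodType) (h : {additive T -> Z}) :
  balanced I (fun x m => h (t x m)).
Proof.
split=> [x y m Ix Iy|x m m' Ix|x a m Ix].
- by rewrite tensorDl // raddfD.
- by rewrite tensorDr // raddfD.
- by rewrite tensorA.
Qed.

(** This is the uniqueness clause, applied to the balanced map that [h'] induces. It plays the part
    of generation by pure tensors. *)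
Lemma tensor_ext (Z : zmodType) (h h' : {additive T -> Z}) :
  (forall x m, I x -> h (t x m) = h' (t x m)) -> h =1 h'.
Proof.
case: tT => _ /(_ _ _ (balanced_additive h'))[h0 [_ hU]] hh z.
by rewrite (hU h) // -(hU h').
Qed.

End Tensor.

(** * Natural transformations out of dual projection functors *)

Section DualProjection.
Implicit Types (I : A -> Prop) (F G : functor (fgmod_cat A) (fgmod_cat A)).

Definition is_dual_projection I F (t : forall M : fgmod A, A -> M -> (F M : fgmod A)) : Prop :=
    [/\ forall M, is_tensor I (t M),
        forall (M : fgmod A) a x (m : M), I x -> t M (a * x) m = a *: t M x m
      & forall (M N : fgmod A) (f : {linear M -> N}) x m, I x ->
          (fmap F (f : @hom (fgmod_cat A) M N) : {linear _ -> _}) (t M x m)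
            = t N x (f m)].

Definition ncomp_lin F G (s : nattrans F G) (M : fgmod A) :
  {linear (F M : fgmod A) -> (G M : fgmod A)} := s M.

Definition fmap_lin F (M N : fgmod A) (f : {linear M -> N}) :
  {linear (F M : fgmod A) -> (F N : fgmod A)} := fmap F (f : @hom (fgmod_cat A) M N).

Lemma ncomp_linE F G (s : nattrans F G) (M N : fgmod A) (f : {linear M -> N}) x :
  ncomp_lin s N (fmap_lin F f x) = fmap_lin G f (ncomp_lin s M x).
Proof. exact: (congr1 (fun u : {linear _ -> _} => u x) (nnat s f)). Qed.

Lemma dual_projection_eq I F G t (s s' : nattrans F G) : is_dual_projection I t ->
  (forall (M : fgmod A) x (m : M), I x -> ncomp_lin s M (t M x m) = ncomp_lin s' M (t M x m)) ->
  s = s'.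
Proof.
move=> [tT _ _] ss; apply: nattransP => M; apply: linearP_ext.
exact: (tensor_ext (h := ncomp_lin s M) (h' := ncomp_lin s' M) (tT M)) (ss M).
Qed.

(** The universal property yields only additive maps; their A-linearity and naturality are then
    checked on pure tensors by [tensor_ext]. *)
Lemma dual_projection_lift I F G t (b : forall M : fgmod A, A -> M -> (G M : fgmod A)) :
  two_sided_ideal I -> is_dual_projection I t ->
  (forall M, balanced I (b M)) ->
  (forall (M : fgmod A) a x (m : M), I x -> b M (a * x) m = a *: b M x m) ->
  (forall (M N : fgmod A) (f : {linear M -> N}) x m, I x -> fmap_lin G f (b M x m) = b N x (f m)) ->
  exists s : nattrans F G, forall (M : fgmod A) x m, I x -> ncomp_lin s M (t M x m) = b M x m.
Proof.
move=> [_ _ Il _] [tT tl tN] bB bl bN.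
pose h M := sval (cid (tensor_lift (tT M) (bB M))).
have hE M x m : I x -> h M (t M x m) = b M x m by exact: (svalP (cid (tensor_lift (tT M) (bB M)))).
have hZ M a z : h M (a *: z) = a *: h M z.
  have u1 : zmod_morphism (fun z => h M (a *: z)) by move=> y y'; rewrite scalerBr raddfB.
  have u2 : zmod_morphism (fun z => a *: h M z) by move=> y y'; rewrite raddfB scalerBr.
  apply: (tensor_ext (h := pack_additive u1) (h' := pack_additive u2) (tT M)) => x m Ix /=.
  by rewrite -tl // hE ?hE //; [exact: bl | exact: Il].
have hL M : linear (h M) by move=> a y z; rewrite raddfD /= hZ.
have sN (M N : fgmod_cat A) (f : hom M N) :
    comp (pack_linear (hL N) : @hom (fgmod_cat A) (F N) (G N)) (fmap F f) =
    comp (fmap G f) (pack_linear (hL M) : @hom (fgmod_cat A) (F M) (G M)).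
  apply: linearP_ext => z.
  apply: (tensor_ext
    (h := hom_lin (comp (pack_linear (hL N) : @hom (fgmod_cat A) (F N) (G N)) (fmap F f)))
    (h' := hom_lin (comp (fmap G f) (pack_linear (hL M) : @hom (fgmod_cat A) (F M) (G M))))
    (tT M)) => x m Ix /=.
  by rewrite [fmap F f _](tN M N f) // hE // hE // -(bN M N f).
by exists (NatTrans (F := F) (G := G) sN) => M x m Ix; rewrite -hE.
Qed.

Lemma dual_projection_isom I F G : two_sided_ideal I ->
  dual_projection I F -> dual_projection I G -> @isom (funcat _ _) F G.
Proof.
move=> idI [t tF] [t' tG].
have [tT tl tN] := tF; have [tT' tl' tN'] := tG.
have bal (M : fgmod A) (T : zmodType) (u : A -> M -> T) : is_tensor I u -> balanced I u by case.
have [s sE] := dual_projection_lift idI tF (fun M => bal _ _ _ (tT' M)) tl' tN'.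
have [s' sE'] := dual_projection_lift idI tG (fun M => bal _ _ _ (tT M)) tl tN.
exists s, s'; split.
  by apply: (dual_projection_eq tG) => M x m Ix; rewrite /ncomp_lin /= [s' M _]sE' //; exact: sE.
by apply: (dual_projection_eq tF) => M x m Ix; rewrite /ncomp_lin /= [s M _]sE //; exact: sE'.
Qed.

Lemma dual_projection_id : dual_projection (fun=> True) (idF (fgmod_cat A)).
Proof.
exists (fun M x m => x *: m); split=> [M|M a x m _|M N f x m _]; last 2 first.
- by rewrite scalerA.
- exact: linearZ.
split; first by split=> *; rewrite ?scalerDl ?scalerDr ?scalerA.
move=> Z b [bDl bDr bA].
have b1 x m : b 1 (x *: m) = b x m by rewrite -bA // mul1r.
have bZ : zmod_morphism (b 1).
  by move=> x y; apply: (addIr (b 1 y)); rewrite -bDr // !subrK.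
exists (pack_additive bZ); split=> [x m _|h' hE m] /=; first exact: b1.
by rewrite -[m in LHS]scale1r hE.
Qed.

Lemma dual_projection_zero I F : (forall x, I x -> x = 0) -> dual_projection I F ->
  @is_zero (funcat _ _) F.
Proof.
move=> I0 [t tF]; have [tT tl _] := tF.
apply: (dual_projection_eq tF) => M x m Ix.
have x0 := I0 x Ix; rewrite {}x0 in Ix *.
by rewrite (tensor0l (tT M)) // raddf0.
Qed.

(** An endomorphism of the bimodule [I], represented by a total function whose values outside [I]
    are irrelevant. *)
Definition bimod_endo I (f : A -> A) : Prop :=
  [/\ forall x, I x -> I (f x),
      forall x y, I x -> I y -> f (x + y) = f x + f y,
      forall a x, I x -> f (a * x) = a * f x
    & forall x a, I x -> f (x * a) = f x * a].

Lemma dual_projection_endo I F t (f : A -> A) : two_sided_ideal I ->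
  is_dual_projection I t -> bimod_endo I f ->
  exists s : nattrans F F,
    forall (M : fgmod A) x (m : M), I x -> ncomp_lin s M (t M x m) = t M (f x) m.
Proof.
move=> idI tF [fI fD fl fr]; have [tT tl tN] := tF.
apply: (dual_projection_lift (b := fun M x m => t M (f x) m)) => // [M|M a x m Ix|M N g x m Ix].
- split=> [x y m Ix Iy|x m m' Ix|x a m Ix].
  + by rewrite fD // (tensorDl (tT M)) //; exact: fI.
  + by rewrite (tensorDr (tT M)) //; exact: fI.
  + by rewrite fr // (tensorA (tT M)) //; exact: fI.
- by rewrite fl // tl //; exact: fI.
- by apply: tN; exact: fI.
Qed.

(** The natural idempotent induced by [f] splits, and its image is the tensor functor of the image
    of [f], written as the set of fixed points of [f] in [I]. *)
Lemma dual_projection_summand I F t (f : A -> A) : two_sided_ideal I ->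
  is_dual_projection I t -> bimod_endo I f -> (forall x, I x -> f (f x) = f x) ->
  exists (F1 : functor (fgmod_cat A) (fgmod_cat A)) (i : nattrans F1 F) (p : nattrans F F1),
    dual_projection (fun x => I x /\ f x = x) F1 /\
    forall (M : fgmod A) x (m : M), I x -> ncomp_lin (nvcomp i p) M (t M x m) = t M (f x) m.
Proof.
move=> idI tF fE ff; have [fI fD fl fr] := fE.
have [s sE] := dual_projection_endo idI tF fE; have [tT tl tN] := tF.
have ss : @comp (funcat _ _) _ _ _ s s = s.
  apply: (dual_projection_eq tF) => M x m Ix.
  by rewrite [LHS](_ : _ = ncomp_lin s M (ncomp_lin s M (t M x m))) // !sE ?ff //; exact: fI.
have [F1 [i [p [pi ip]]]] := split_funcat split_fgmod ss.
exists F1, i, p; split; last by move=> M x m Ix; rewrite -sE //; congr (ncomp_lin _ M _).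
have piE (M : fgmod A) (z : (F1 M : fgmod A)) : ncomp_lin p M (ncomp_lin i M z) = z.
  exact: (congr1 (fun u : {linear (F1 M : fgmod A) -> (F1 M : fgmod A)} => u z)
    (nattrans_eq (M : fgmod_cat A) pi)).
have ipE (M : fgmod A) x (m : M) : I x -> ncomp_lin i M (ncomp_lin p M (t M x m)) = t M (f x) m.
  by move=> Ix; rewrite -sE // -ip.
exists (fun M x m => ncomp_lin p M (t M x m)); split=> [M|M a x m [Ix fx]|M N g x m [Ix fx]].
- split.
    split=> [x y m [Ix _] [Iy _]|x m m' [Ix _]|x a m [Ix _]].
    + by rewrite (tensorDl (tT M)) // raddfD.
    + by rewrite (tensorDr (tT M)) // raddfD.
    + by rewrite (tensorA (tT M)).
  move=> Z b [bDl bDr bA].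
  have If x : I x -> I (f x) /\ f (f x) = f x by move=> Ix; split; [exact: fI | exact: ff].
  (* A balanced map on the image of [f] is extended to all of [I] by precomposing with [f], so that
     the universal property of [F M] applies. *)
  have bB : balanced I (fun x m => b (f x) m).
    split=> [x y m Ix Iy|x m m' Ix|x a m Ix].
    + by rewrite fD // bDl //; exact: If.
    + by rewrite bDr //; exact: If.
    + by rewrite fr // bA //; exact: If.
  have [h hE] := tensor_lift (tT M) bB.
  have hiB : zmod_morphism (fun z => h (ncomp_lin i M z)) by move=> x y; rewrite !raddfB.
  exists (pack_additive hiB); split=> [x m [Ix fx]|h' h'E z] /=.
    by rewrite ipE // fx hE // fx.
  rewrite -[z in LHS]piE.
  have hpB : zmod_morphism (fun z => h' (ncomp_lin p M z)) by move=> x y; rewrite !raddfB.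
  apply: (tensor_ext (h := pack_additive hpB) (h' := h) (tT M)) => x m Ix /=.
  rewrite hE // -h'E; last exact: If.
  by rewrite -ipE // piE.
- by rewrite tl // linearZ.
- have := ncomp_linE p g (t M x m); rewrite -[fmap_lin F1 g _]/(fmap F1 _ _) => <-.
  by congr (ncomp_lin p N _); apply: tN.
Qed.

(** Evaluation at the regular module identifies natural endomorphisms of [F] with bimodule
    endomorphisms of [I]: x |-> x ⊗ 1 is a bijection from [I] to I ⊗ A, and naturality along the
    maps 1 |-> m determines everything else. *)
Lemma dual_projection_brick I F (e : {additive A -> A}) : two_sided_ideal I ->
  dual_projection I F -> (forall x, I (e x)) -> (forall x, I x -> e x = x) ->
  (exists2 x, I x & x <> 0) ->
  (forall f, bimod_endo I f -> (forall x, I x -> f x = 0) \/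
     exists2 g, bimod_endo I g & forall x, I x -> f (g x) = x /\ g (f x) = x) ->
  @brick (funcat _ _) F.
Proof.
move=> idI [t tF] eI Ie [x0 Ix0 x00] endoI; have [I0 ID Il Ir] := idI.
have [tT tl tN] := tF.
have IN x : I x -> I (- x) by rewrite -mulN1r => Ix; apply: Il.
have bM : balanced I (fun x (m : A^o) => x * m : A).
  split=> [x y m _ _|x m m' _|x a m _]; [exact: mulrDl|exact: mulrDr|exact/esym/mulrA].
have [h hE] := tensor_lift (tT regular_mod) bM.
(* The multiplication map [h] takes values in [A]. It lands in [I] because it agrees with its
   composite with the additive retraction [e] on pure tensors. *)
have hI (z : (F regular_mod : fgmod A)) : I (h z).
  suff -> : h z = e (h z) by [].
  have eh : zmod_morphism (fun z => e (h z)) by move=> x y; rewrite !raddfB.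
  apply: (tensor_ext (h := h) (h' := pack_additive eh) (tT regular_mod)) => x m Ix /=.
  by rewrite hE // Ie //; exact: Ir.
have hK (z : (F regular_mod : fgmod A)) : t regular_mod (h z) (1 : A^o) = z.
  have tB : zmod_morphism (fun z => t regular_mod (h z) (1 : A^o)).
    move=> x y; rewrite raddfB; apply: (addIr (t regular_mod (h y) (1 : A^o))).
    by rewrite -(tensorDl (tT regular_mod)) ?subrK //; apply: ID => //; exact: IN.
  have idB : zmod_morphism (@id (F regular_mod : fgmod A)) by [].
  apply: (tensor_ext (h := pack_additive tB) (h' := pack_additive idB) (tT regular_mod)) => x m Ix /=.
  rewrite hE // (tensorA (tT regular_mod)) //; congr t.
  exact: mulr1.
have tM (M : fgmod A) (m : M) : exists f : {linear regular_mod -> M}, f (1 : A^o) = m.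
  have mL : linear (fun a : A^o => (a : A) *: m) by move=> a u v; rewrite scalerDl -scalerA.
  by exists (pack_linear mL : {linear regular_mod -> M}); exact: scale1r.
split=> [F0|s].
  have F00 : t regular_mod x0 (1 : A^o) = 0 := congr1
    (fun u : {linear (F regular_mod : fgmod A) -> (F regular_mod : fgmod A)} =>
       u (t regular_mod x0 (1 : A^o)))
    (is_zero_funcatE (regular_mod : fgmod_cat A) F0).
  by move/(congr1 h): F00; rewrite hE // mulr1 raddf0.
pose f x := h (ncomp_lin s regular_mod (t regular_mod x (1 : A^o))).
have sE (M : fgmod A) x (m : M) : I x -> ncomp_lin s M (t M x m) = t M (f x) m.
  move=> Ix; have [g <-] := tM M m.
  rewrite -(tN regular_mod M g) // -[in RHS](tN regular_mod M g) /f ?hK //.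
  exact: (ncomp_linE s g).
have fE : bimod_endo I f.
  split=> [x Ix|x y Ix Iy|a x Ix|x a Ix]; rewrite /f //.
  - by rewrite (tensorDl (tT regular_mod)) // !raddfD.
  - rewrite tl // linearZ.
    have al : zmod_morphism (fun z => h (a *: z)) by move=> u v; rewrite scalerBr raddfB.
    have ar : zmod_morphism (fun z => a * h z) by move=> u v; rewrite raddfB mulrBr.
    apply: (tensor_ext (h := pack_additive al) (h' := pack_additive ar) (tT regular_mod)) => y m Iy /=.
    by rewrite -tl // !hE ?mulrA //; exact: Il.
  - rewrite (tensorA (tT regular_mod)) // sE // hE; last exact: hI.
    by rewrite /f /GRing.scale /= mulr1.
have [f0|[g gE gf]] := endoI f fE; [left|right].
  apply: (dual_projection_eq tF) => M x m Ix; by rewrite sE // f0 // (tensor0l (tT M)).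
have [s' sE'] := dual_projection_endo idI tF gE.
have [fI _ _ _] := fE; have [gI _ _ _] := gE.
exists s'; split; apply: (dual_projection_eq tF) => M x m Ix.
  rewrite [LHS](_ : _ = ncomp_lin s M (ncomp_lin s' M (t M x m))) // sE' // sE; last exact: gI.
  by have [-> _] := gf x Ix.
rewrite [LHS](_ : _ = ncomp_lin s' M (ncomp_lin s M (t M x m))) // sE // sE'; last exact: fI.
by have [_ ->] := gf x Ix.
Qed.

End DualProjection.
End Modules.

(** * Ideals of an admissible oriented tree *)

Section Tree.
Variables (n : nat) (e : rel 'I_n).
Local Notation le := (connect e).

(** Adjacency in the tree with [u] deleted; its components are the branches at [u]. *)
Definition adj_off (u : 'I_n) : rel 'I_n :=
  fun a b => [&& adjacent e a b, a != u & b != u].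

Lemma adjacentC i j : adjacent e i j = adjacent e j i.
Proof. by rewrite /adjacent orbC. Qed.

Lemma adj_offC u : connect_sym (adj_off u).
Proof.
by apply: sym_connect_sym => a b; rewrite /adj_off adjacentC [(a != u) && _]andbC.
Qed.

Lemma path_adj_off u a p :
  path (adjacent e) a p -> u \notin a :: p -> path (adj_off u) a p.
Proof.
elim: p a => //= b p IH a /andP[ab bp]; rewrite inE negb_or => /andP[ua up].
rewrite IH // andbT /adj_off ab eq_sym ua /= eq_sym.
by move: up; rewrite inE negb_or; case/andP.
Qed.

Hypothesis ht : oriented_tree e.

Lemma arrow_asym i j : e i j -> e j i = false.
Proof. by case: ht => as_ _ _ /as_/negbTE. Qed.

Lemma arrow_irr i : e i i = false.
Proof. by apply/negP => ii; have := arrow_asym ii; rewrite ii. Qed.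

Lemma adjacent_neq i j : adjacent e i j -> i != j.
Proof. by apply: contraTneq => ->; rewrite /adjacent arrow_irr. Qed.

(** A walk from a to b avoiding u, once shortened to a simple one, would close up through u to a
    cycle of length at least 3. *)
Lemma separated u a b : adjacent e u a -> adjacent e u b -> a != b ->
  ~~ connect (adj_off u) a b.
Proof.
case: ht => _ _ acyc ua ub ab; apply/negP => /connectP[p pp bE]; move: ab ub.
rewrite {}bE; case/shortenP: pp => {}p pp up _ ab ub.
case: p pp up ab ub => [|c p pp up _ ub]; first by rewrite eqxx.
apply: (acyc [:: u, a, c & p]) => //.
have padj : path (adjacent e) a (c :: p).
  by apply: sub_path pp => x y /and3P[].
have : all (predC1 u) (a :: c :: p).
  move: pp; rewrite /= => /andP[/and3P[_ -> cu] pp]; rewrite cu /=.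
  elim: p c cu pp {up ub padj} => //= d p IH c cu /andP[/and3P[_ _ du] pp].
  by rewrite du (IH d).
move=> /allP H; have nu : u \notin [:: a, c & p] by apply/negP => /H /=; rewrite eqxx.
rewrite /ucycle cons_uniq nu up !andbT /cycle rcons_path /= ua.
by move: padj => /= ->; rewrite adjacentC.
Qed.

(** If two simple walks left u by different neighbours and met again, those neighbours would lie on
    one branch at u. *)
Lemma walk_inj u s s' :
  path (adjacent e) u s -> uniq (u :: s) ->
  path (adjacent e) u s' -> uniq (u :: s') -> last u s = last u s' -> s = s'.
Proof.
elim: s u s' => [|v s IH] u [|v' s'] //=.
- by move=> _ _ _ /andP[/negP nu _] uE; case: nu; rewrite [X in X \in _]uE mem_last.
- by move=> _ /andP[/negP nu _] _ _ uE; case: nu; rewrite -[X in X \in _]uE mem_last.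
move=> /andP[uv vs] /andP[nu us] /andP[uv' vs'] /andP[nu' us'] lE.
have [vv|vv] := eqVneq v v'.
  by rewrite -vv in vs' us' lE *; congr cons; apply: IH lE.
have /negP[] := separated uv uv' vv.
apply: (@connect_trans _ _ (last v s)).
  by apply/connectP; exists s => //; exact: path_adj_off.
by rewrite adj_offC lE; apply/connectP; exists s' => //; exact: path_adj_off.
Qed.

Lemma arrow_not_back u v : e u v -> ~~ le v u.
Proof.
move=> uv; apply/negP => /connectP[p pp uE]; move: uv; rewrite {}uE.
case/shortenP: pp => {}p pp up _ lv.
case: ht => _ _ acyc.
have sz : (2 < size (v :: p))%N.
  case: p pp up lv => [|w [|x p]] //=; first by rewrite arrow_irr.
  by rewrite andbT => vw _ wv; rewrite (arrow_asym vw) in wv.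
apply: (acyc _ sz); rewrite /ucycle up andbT /cycle rcons_path.
rewrite (sub_path _ pp) => [|x y xy]; last by rewrite /adjacent xy.
by rewrite /= /adjacent lv.
Qed.

Lemma dpath_uniq u s : path e u s -> uniq (u :: s).
Proof.
elim: s u => //= v s IH u /andP[uv vs].
have /= -> := IH _ vs; rewrite andbT; apply/negP => us.
by have /negP[] := arrow_not_back uv; apply: path_connect vs _ us.
Qed.

Lemma dpath_inj u s s' : path e u s -> path e u s' -> last u s = last u s' -> s = s'.
Proof.
have sub x p : path e x p -> path (adjacent e) x p.
  by apply: sub_path => a b ab; rewrite /adjacent ab.
by move=> us us'; apply: walk_inj; rewrite ?dpath_uniq ?sub.
Qed.

(** Both factorizations cut the unique directed path from i to l, so the shorter initial piece is a
    prefix of the longer one. *)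
Lemma interval_chain i l j j' : le i j -> le j l -> le i j' -> le j' l ->
  le j j' \/ le j' j.
Proof.
move=> /connectP[s1 p1 jE] /connectP[s2 p2 lE] /connectP[s1' p1' jE'] /connectP[s2' p2' lE'].
wlog sz : j j' s1 s2 s1' s2' p1 jE p2 lE p1' jE' p2' lE' / (size s1 <= size s1')%N.
  move=> H; case: (leqP (size s1) (size s1')) => [|/ltnW] sz; first exact: (H j j' s1 s2 s1' s2').
  by apply/or_comm; exact: (H j' j s1' s2' s1 s2).
left; have ss : s1 ++ s2 = s1' ++ s2'.
  apply: (@dpath_inj i); rewrite ?cat_path ?p1 ?p1' -?jE -?jE' //.
  by rewrite !last_cat -jE -jE' -lE -lE'.
have := congr1 (take (size s1)) ss; rewrite take_size_cat // take_cat.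
rewrite ltn_neqAle sz andbT; case: eqP => [szE|_] /= s1E.
  rewrite jE' jE s1E szE subnn take0 cats0; exact: connect0.
rewrite jE' -(cat_take_drop (size s1) s1') -s1E last_cat -jE.
apply/connectP; exists (drop (size s1) s1') => //.
by move: p1'; rewrite -{1}(cat_take_drop (size s1) s1') -s1E cat_path -jE => /andP[].
Qed.

Hypothesis hadm : admissible e.

(** An incoming arrow besides the two outgoing ones would give degree at least 3, so admissibility
    would make u a sink or a source, which it is not. *)
Lemma two_out_source u a b : e u a -> e u b -> a != b -> is_source e u.
Proof.
move=> ua ub ab; apply: contraT => /forallPn[c]; rewrite negbK => cu.
have : u \in Kset e.
  apply: hadm; have [ca cb] : c != a /\ c != b.
    by split; apply: contraTneq cu => ->; rewrite arrow_asym.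
  have <- : #|[set a; b; c]| = 3%N.
    rewrite -setUA cardsU1 !inE cards2 (negbTE ab) eq_sym (negbTE ca) /=.
    by rewrite eq_sym cb.
  apply/subset_leq_card/subsetP => x; rewrite !inE /adjacent.
  by case/orP=> [/orP[]|] /eqP->; rewrite ?ua ?ub ?cu ?orbT.
by rewrite inE => /orP[/forallP/(_ a)|/forallP/(_ c)]; rewrite ?ua ?cu.
Qed.

Lemma two_in_sink u a b : e a u -> e b u -> a != b -> is_sink e u.
Proof.
move=> ua ub ab; apply: contraT => /forallPn[c]; rewrite negbK => cu.
have : u \in Kset e.
  apply: hadm; have [ca cb] : c != a /\ c != b.
    by split; apply: contraTneq cu => ->; rewrite arrow_asym.
  have <- : #|[set a; b; c]| = 3%N.
    rewrite -setUA cardsU1 !inE cards2 (negbTE ab) eq_sym (negbTE ca) /=.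
    by rewrite eq_sym cb.
  apply/subset_leq_card/subsetP => x; rewrite !inE /adjacent.
  by case/orP=> [/orP[]|] /eqP->; rewrite ?ua ?ub ?cu ?orbT.
by rewrite inE => /orP[/forallP/(_ c)|/forallP/(_ a)]; rewrite ?ua ?cu.
Qed.

Lemma connect_first i j : le i j -> i = j \/ exists2 v, e i v & le v j.
Proof.
case/connectP=> [[|v s]] /=; first by left.
by case/andP=> iv vs jE; right; exists v => //; apply/connectP; exists s.
Qed.

Lemma connect_last i j : le i j -> i = j \/ exists2 v, le i v & e v j.
Proof.
case/connectP=> s; case: (lastP s) => [|{}s v] /=; first by left.
rewrite rcons_path last_rcons => /andP[iv vs] ->; right.
by exists (last i s) => //; apply/connectP; exists s.
Qed.

(** A fork above u would occur at a vertex with two outgoing arrows, hence at a source; but every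
    vertex met has an incoming arrow, the first one from a. *)
Lemma le_chain_up u a b c : e a u -> le u b -> le u c -> le b c \/ le c b.
Proof.
move=> au /connectP[s]; elim: s a u au => [|v s IH] a u au /=.
  by move=> _ -> uc; left.
case/andP=> uv vs bE uc; have ub : le u b.
  by rewrite bE; apply: connect_trans (connect1 uv) _; apply/connectP; exists s.
case: (connect_first uc) => [<-|[v' uv' vc]]; first by right.
have [vv|vv] := eqVneq v v'; first by apply: IH uv vs bE _; rewrite vv.
by have /forallP/(_ a) := two_out_source uv uv' vv; rewrite au.
Qed.

Lemma le_chain_down u a b c : e u a -> le b u -> le c u -> le b c \/ le c b.
Proof.
move=> ua /connectP[s]; elim/last_ind: s a u ua => [|s v IH] a u ua /=.
  by move=> _ -> uc; right.
rewrite rcons_path last_rcons => /andP[vs lv] uE; rewrite uE in ua * => cu.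
case: (connect_last cu) => [->|[v' cv' vu]].
  left; apply: connect_trans (connect1 lv).
  by apply/connectP; exists s.
have [vv|vv] := eqVneq (last b s) v'; first by apply: (IH _ _ lv vs); rewrite vv.
by have /forallP/(_ a) := two_in_sink lv vu vv; rewrite ua.
Qed.

(** A directed path cannot leave a sink, so a path that does not end at u avoids u altogether. *)
Lemma sink_branch u a z : is_sink e u -> le a z -> z != u -> connect (adj_off u) a z.
Proof.
move=> snk /connectP[s ps ->] zu.
apply/connectP; exists s => //; apply: path_adj_off.
  by apply: sub_path ps => x y xy; rewrite /adjacent xy.
apply: contra zu => us; case: (splitPl us) ps => p1 p2 lu.
rewrite last_cat cat_path lu; case: p2 => //= v p2 /and3P[_ uv _].
by have /forallP/(_ v) := snk; rewrite uv.
Qed.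

Lemma source_branch u b z : is_source e u -> le z b -> z != u -> connect (adj_off u) b z.
Proof.
move=> src /connectP[s ps ->] zu; rewrite adj_offC.
apply/connectP; exists s => //; apply: path_adj_off.
  by apply: sub_path ps => x y xy; rewrite /adjacent xy.
rewrite inE negb_or eq_sym zu /=; apply/negP => us.
case: (splitPr us) ps => p1 p2; rewrite cat_path /= => /and3P[_ uv _].
by have /forallP/(_ (last z p1)) := src; rewrite uv.
Qed.

(** [X i j] says that the path from i to j is in the ideal; a pair of vertices codes a path because
    directed paths are unique. *)
Definition path_ideal (X : rel 'I_n) : Prop :=
  (forall i j, X i j -> le i j) /\
  (forall a i j b, le a i -> X i j -> le j b -> X a b).

(** For an ideal [X], this says that [S] cuts out a union of connected components under extension of
    paths. Connectedness below is tested on such [S], without forming components. *)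
Definition clopen (X S : rel 'I_n) : Prop :=
  forall a i j b, le a i -> X i j -> le j b -> S i j = S a b.

Definition conn_ideal (X : rel 'I_n) : Prop :=
  [/\ path_ideal X, exists i j, X i j
    & forall S, clopen X S -> forall i j i' j', X i j -> X i' j' -> S i j = S i' j'].

(** The order follows the product of paths: [Y] is traversed before [X]. *)
Definition prod_ideal (X Y : rel 'I_n) : rel 'I_n :=
  fun i l => [exists j, Y i j && X j l].

(* If the trivial path at a sink or source u is not in X, the connected ideal X
   lives on a single branch of the tree at u. *)
Lemma conn_branch X u i j i' j' w w' : conn_ideal X -> u \in Kset e ->
  ~~ X u u -> X i j -> X i' j' ->
  le i w -> le w j -> w != u -> le i' w' -> le w' j' -> w' != u ->
  connect (adj_off u) w w'.
Proof.
move=> [[Xle Xid] _ Xconn] uK Xuu Xij Xij' iw wj wu iw' wj' wu'.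
(* [T] selects the paths that meet the branch of [w'] at u. A path has u only at an end, so its
   other vertices share one branch and [T] is clopen. *)
pose T a b := [exists z, [&& le a z, le z b, z != u & connect (adj_off u) z w']].
have branch a b z1 z2 : le a z1 -> le z1 b -> z1 != u -> le a z2 -> le z2 b ->
    z2 != u -> connect (adj_off u) z1 z2.
  move=> az1 z1b z1u az2 z2b z2u; move: uK; rewrite inE => /orP[su|su].
    apply: connect_trans (sink_branch su az2 z2u).
    by rewrite adj_offC; exact: sink_branch.
  apply: connect_trans (source_branch su z2b z2u).
  by rewrite adj_offC; exact: source_branch.
have Tclopen : clopen X T.
  move=> a k l b ak Xkl lb; have kl := Xle _ _ Xkl.
  apply/existsP/existsP => [] [z /and4P[az zb zu zw]].
    by exists z; rewrite zu zw (connect_trans ak az) (connect_trans zb lb).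
  (* Since [X u u] fails, the path from k to l is not trivial at u, and one of its ends differs from
     u. *)
  have [v [kv vl vu]] : exists v, [/\ le k v, le v l & v != u].
    have [ku|ku] := eqVneq k u; last by exists k; rewrite connect0.
    have [lu|lu] := eqVneq l u; last by exists l; rewrite connect0.
    by move: Xkl Xuu; rewrite ku lu => ->.
  exists v; rewrite kv vl vu /=; apply: connect_trans zw.
  apply: (branch a b) => //; first exact: connect_trans kv.
  exact: connect_trans lb.
have : T i' j' by apply/existsP; exists w'; rewrite iw' wj' wu' connect0.
rewrite -(Xconn T Tclopen i j i' j') // => /existsP[z /and4P[iz zj zu zw]].
by apply: connect_trans zw; apply: (branch i j).
Qed.

(** * Connectedness of the product of two connected ideals *)

Section Product.
Variables (X Y : rel 'I_n).

Lemma prod_path_ideal : path_ideal X -> path_ideal Y -> path_ideal (prod_ideal X Y).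
Proof.
move=> [Xle Xid] [Yle Yid]; split=> [i l /existsP[j /andP[/Yle ij /Xle]]|].
  exact: connect_trans.
move=> a i l b ai /existsP[j /andP[Yij Xjl]] lb; apply/existsP; exists j.
by rewrite (Yid _ _ _ _ ai Yij) ?connect0 // (Xid _ _ _ _ _ Xjl lb).
Qed.

Hypotheses (cX : conn_ideal X) (cY : conn_ideal Y).
Let Z := prod_ideal X Y.

Let ZidP : path_ideal Z.
Proof. by apply: prod_path_ideal; [case: cX | case: cY]. Qed.

Let Zle i j : Z i j -> le i j. Proof. by case: ZidP => + _; apply. Qed.
Let Zid a i j b : le a i -> Z i j -> le j b -> Z a b.
Proof. by case: ZidP => _; apply. Qed.

(** If [X u u] and [Y u u] both held, then so would [Z u u]. So [conn_branch] applies to one factor,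
    and both factors contain [Z]. This is where connectedness of [X] and [Y] enters. *)
Let Z_branch u i j i' j' w w' : u \in Kset e ->
  ~~ Z u u -> Z i j -> Z i' j' ->
  le i w -> le w j -> w != u -> le i' w' -> le w' j' -> w' != u ->
  connect (adj_off u) w w'.
Proof.
move=> uK Zuu Zij Zij'.
have ZX a b : Z a b -> X a b.
  case/existsP=> c /andP[Yac Xcb]; case: cX cY => [[_ Xid] _ _] [[Yle _] _ _].
  by apply: Xid Xcb (connect0 _ _); apply: Yle.
have ZY a b : Z a b -> Y a b.
  case/existsP=> c /andP[Yac Xcb]; case: cX cY => [[Xle _] _ _] [[_ Yid] _ _].
  by apply: Yid (connect0 _ _) Yac _; apply: Xle.
have /orP[uu|uu] : ~~ X u u || ~~ Y u u.
  rewrite -negb_and; apply: contra Zuu => /andP[Xu Yu].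
  by apply/existsP; exists u; rewrite Xu Yu.
  by apply: (@conn_branch X u i j i' j') => //; apply: ZX.
by apply: (@conn_branch Y u i j i' j') => //; apply: ZY.
Qed.

Variable S : rel 'I_n.
Hypothesis clS : clopen Z S.

(** The path from i to j runs along the edge uv in its given orientation. Edges are tracked instead
    of vertices because two paths through a common vertex may fork there. *)
Definition has_edge i j u v :=
  (e u v && le i u && le v j) || (e v u && le i v && le u j).

Let has_edge_r i j u v : has_edge i j u v -> le i v /\ le v j.
Proof.
case/orP=> /andP[/andP[xy H1] H2]; split=> //.
  exact: connect_trans H1 (connect1 xy).
exact: connect_trans (connect1 xy) H2.
Qed.

(** Inside one component, a path through u is replaced by one along the next edge uv of a walk
    towards w. If the path stops at u it is extended; if it turns off to another neighbour, then u
    is a source or a sink and the trivial path at u serves as a link. *)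
Let step_edge i j u v i' j' w : Z i j -> le i u -> le u j -> adjacent e u v ->
  Z i' j' -> le i' w -> le w j' -> w != u -> connect (adj_off u) v w ->
  exists i2 j2, [/\ Z i2 j2, S i j = S i2 j2 & has_edge i2 j2 u v].
Proof.
move=> Zij iu uj uv Zij' iw wj wu vw; case/orP: (uv) => euv.
  have [uE|[u' uu' uj']] := connect_first uj.
    have jv : le j v by rewrite -uE connect1.
    exists i, v; split; first exact: Zid (connect0 _ _) Zij jv.
      exact: clS (connect0 _ _) Zij jv.
    by rewrite /has_edge euv iu connect0.
  have [vu|vu] := eqVneq u' v.
    by exists i, j; split=> //; rewrite /has_edge euv iu -vu uj'.
  have src := two_out_source uu' euv vu.
  have uK : u \in Kset e by rewrite inE src orbT.
  have iE : i = u.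
    case: (connect_last iu) => // -[x _ xu].
    by have /forallP/(_ x) := src; rewrite xu.
  have auu' : adjacent e u u' by rewrite /adjacent uu'.
  (* Otherwise [Z_branch] puts u' and w, hence u' and v, on one branch at u, against [separated]. *)
  have Zuu : Z u u.
    apply: contraT => Zuu; have /negP[] := separated auu' uv vu.
    rewrite adj_offC; apply: connect_trans vw _; rewrite adj_offC.
    apply: (Z_branch uK Zuu Zij Zij') => //; last first.
      by rewrite eq_sym adjacent_neq.
    exact: connect_trans iu (connect1 uu').
  exists u, v; split.
  - exact: Zid (connect0 _ _) Zuu (connect1 euv).
  - rewrite iE -(clS (connect0 _ _) Zuu uj).
    exact: clS (connect0 _ _) Zuu (connect1 euv).
  - by rewrite /has_edge euv !connect0.
have [uE|[u' iu' uu']] := connect_last iu.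
  have vi : le v i by rewrite uE connect1.
  exists v, j; split; first exact: Zid vi Zij (connect0 _ _).
    exact: clS vi Zij (connect0 _ _).
  by rewrite /has_edge euv uj connect0 orbT.
have [vu|vu] := eqVneq u' v.
  by exists i, j; split=> //; rewrite /has_edge euv uj -vu iu' orbT.
have snk := two_in_sink uu' euv vu.
have uK : u \in Kset e by rewrite inE snk.
have jE : u = j.
  case: (connect_first uj) => // -[x ux _].
  by have /forallP/(_ x) := snk; rewrite ux.
have auu' : adjacent e u u' by rewrite /adjacent uu' orbT.
have Zuu : Z u u.
  apply: contraT => Zuu; have /negP[] := separated auu' uv vu.
  rewrite adj_offC; apply: connect_trans vw _; rewrite adj_offC.
  apply: (Z_branch uK Zuu Zij Zij') => //; last first.
    by rewrite eq_sym adjacent_neq.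
  exact: connect_trans (connect1 uu') uj.
exists v, u; split.
- exact: Zid (connect1 euv) Zuu (connect0 _ _).
- rewrite -jE -(clS iu Zuu (connect0 _ _)).
  exact: clS (connect1 euv) Zuu (connect0 _ _).
- by rewrite /has_edge euv !connect0 orbT.
Qed.

(** The starts, all below x, form a chain, and so do the ends, all above y. The two paths are thus
    linked through the one from the earlier start to the other path's end. *)
Let common_edge i j i' j' x y : e x y -> le i x -> le y j -> le i' x -> le y j' ->
  Z i j -> Z i' j' -> S i j = S i' j'.
Proof.
move=> xy ix yj i'x yj' Zij Zij'.
wlog ii : i j i' j' ix yj i'x yj' Zij Zij' / le i i'.
  move=> H; case: (le_chain_down xy ix i'x) => ii; first exact: H.
  by apply/esym; apply: H.
have ij' : Z i j' by exact: Zid ii Zij' (connect0 _ _).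
rewrite (clS ii Zij' (connect0 _ _)).
case: (le_chain_up xy yj yj') => jj.
  exact: clS (connect0 _ _) Zij jj.
exact/esym/(clS (connect0 _ _) ij' jj).
Qed.

(** Induction along a simple walk whose last edge, from [a] to [b], lies on the target path. As b is
    not u, it shows [step_edge] on which branch the target lies. *)
Let walk_to_edge s i j u i' j' a b :
  path (adjacent e) u s -> uniq (u :: s) -> s != [::] ->
  Z i j -> le i u -> le u j -> Z i' j' ->
  last a (belast u s) = a -> last u s = b -> has_edge i' j' a b -> S i j = S i' j'.
Proof.
elim: s i j u => // v s IH i j u /= /andP[uv vs] /andP[us vus] _ Zij iu uj Zij' aE bE ab.
have bij := has_edge_r ab.
have vb : connect (adj_off u) v b.
  by apply/connectP; exists s => //; exact: path_adj_off.
have bu : b != u.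
  by apply: contraNneq us => <-; rewrite -bE mem_last.
have [i2 [j2 [Z2 -> edge2]]] := step_edge Zij iu uj uv Zij' bij.1 bij.2 bu vb.
case: s IH vs us vus aE bE vb => [|v' s] IH vs us vus aE bE vb.
  move: edge2 ab; rewrite /= in aE bE; rewrite -bE aE /has_edge.
  case/orP=> /andP[/andP[E1 E2 E3]] /orP[] /andP[/andP[F1 F2 F3]].
  - exact: common_edge E1 _ _ _ _ _ _.
  - by rewrite (arrow_asym E1) in F1.
  - by rewrite (arrow_asym E1) in F1.
  - exact: common_edge E1 _ _ _ _ _ _.
have [i2v vj2] := has_edge_r edge2.
exact: (IH i2 j2 v).
Qed.

Hypothesis hn : (1 < n)%N.

(** A trivial path uses no edge, so it is extended by an edge at its vertex; one exists since the
    tree is connected with more than one vertex. *)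
Let nontrivial i j : Z i j ->
  exists i2 j2 a b, [/\ Z i2 j2, S i j = S i2 j2, adjacent e a b & has_edge i2 j2 a b].
Proof.
move=> Zij; case: (connect_first (Zle Zij)) => [ij|[v iv vj]]; last first.
  by exists i, j, i, v; rewrite /has_edge /adjacent iv vj connect0.
rewrite -{}ij in Zij *.
have [v iv] : exists v, adjacent e i v.
  have [x xi] : exists x : 'I_n, x != i.
    have [/eqP i0|i0] := boolP (i == 0 :> nat).
      by exists (Ordinal hn); apply/eqP => /(congr1 val) /=; rewrite i0.
    by exists (Ordinal (ltnW hn)); apply: contraNneq i0 => <-.
  case: ht => _ /(_ i x) /connectP[[|v s] /= ps xE] _; last by exists v; case/andP: ps.
  by rewrite xE eqxx in xi.
case/orP: (iv) => ev.
  exists i, v, i, v; split=> //; first exact: Zid (connect0 _ _) Zij (connect1 ev).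
    exact: clS (connect0 _ _) Zij (connect1 ev).
  by rewrite /has_edge ev !connect0.
exists v, i, i, v; split=> //; first exact: Zid (connect1 ev) Zij (connect0 _ _).
  exact: clS (connect1 ev) Zij (connect0 _ _).
by rewrite /has_edge ev !connect0 orbT.
Qed.

Lemma prod_clopen_const i j i' j' : Z i j -> Z i' j' -> S i j = S i' j'.
Proof.
move=> Zij /nontrivial[i2 [j2 [a [b [Z2 -> ab edge]]]]].
have ij := Zle Zij; have ii : le i i by [].
case: ht => _ /(_ i a) /connectP[s ps aE] _.
move: ab edge; rewrite {}aE; case/shortenP: ps => {}s ps us _ ab edge.
(* The walk must end by crossing the edge ab. If it misses b, then b is appended; if it meets b, it
   is cut there and continued by a, crossing the edge in the other direction. *)
have [bs|bs] := boolP (b \in i :: s); last first.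
  apply: (walk_to_edge (s := rcons s b) (a := last i s)) ii ij Z2 _ (last_rcons _ _ _) edge.
  - by rewrite rcons_path ps.
  - by rewrite -rcons_cons rcons_uniq bs.
  - by rewrite -size_eq0 size_rcons.
  - by [].
  - by rewrite belast_rcons.
case: (splitPl bs) ps us ab edge => p1 p2 lb; rewrite cat_path last_cat.
rewrite -cat_cons cat_uniq lb => /andP[ps _] /and3P[us dis _] ab edge.
have as_ : last b p2 \notin i :: p1.
  case: p2 ab edge dis => [|c p2] ab _ /hasPn; first by have := adjacent_neq ab; rewrite eqxx.
  by move=> /(_ (last c p2) (mem_last _ _)).
apply: (walk_to_edge (s := rcons p1 (last b p2)) (a := b)) ii ij Z2 _ (last_rcons _ _ _) _.
- by rewrite rcons_path ps lb adjacentC.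
- by rewrite -rcons_cons rcons_uniq as_.
- by rewrite -size_eq0 size_rcons.
- by [].
- by rewrite belast_rcons.
- by move: edge; rewrite /has_edge orbC.
Qed.

End Product.

Lemma prod_conn_ideal X Y i j : (1 < n)%N -> conn_ideal X -> conn_ideal Y ->
  prod_ideal X Y i j -> conn_ideal (prod_ideal X Y).
Proof.
move=> hn cX cY Zij; split; last by move=> S clS a b c d; apply: (prod_clopen_const cX cY clS hn).
  by apply: prod_path_ideal; [case: cX | case: cY].
by exists i, j.
Qed.

(** Every path is linked to the trivial path at its start, and each arrow links the trivial paths at
    its two ends; the tree is connected. *)
Lemma full_conn_ideal : (1 < n)%N -> conn_ideal le.
Proof.
move=> hn; split.
- split=> // a i j b ai ij jb; exact: connect_trans ai (connect_trans ij jb).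
- by exists (Ordinal hn), (Ordinal hn); exact: connect0.
move=> S clS; have Sii i j : le i j -> S i j = S i i.
  by move=> ij; apply/esym/clS.
have Sjj i j : e i j -> S i i = S j j.
  move=> ij; rewrite -(Sii _ _ (connect1 ij)); apply/esym.
  by apply: clS (connect1 ij) _ _.
suff H i j : S i i = S j j by move=> i j i' j' /Sii-> /Sii->.
case: ht => _ /(_ i j) /connectP[s ps ->] _.
elim: s i ps => //= v s IH i /andP[iv /IH <-].
by case/orP: iv => /Sjj.
Qed.

Definition split_ideal (X S : rel 'I_n) : rel 'I_n := fun i j => X i j && S i j.

Lemma clopenC (X S : rel 'I_n) : clopen X S -> clopen X (fun i j => ~~ S i j).
Proof. by move=> cl a i j b ai Xij jb; rewrite (cl _ _ _ _ ai Xij jb). Qed.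

Lemma split_path_ideal X S : path_ideal X -> clopen X S -> path_ideal (split_ideal X S).
Proof.
move=> [Xle Xid] clS; split=> [i j /andP[/Xle]//|a i j b ai /andP[Xij Sij] jb].
by rewrite /split_ideal (Xid _ _ _ _ ai Xij jb) -(clS _ _ _ _ ai Xij jb).
Qed.

(** Induction on the number of pairs in [X]: a clopen [S] taking both values on [X] cuts it into two
    smaller ideals, and without such an [S] the ideal is empty or connected. *)
Lemma path_ideal_ind (P : rel 'I_n -> Prop) :
  (forall X, path_ideal X -> (forall i j, ~~ X i j) -> P X) ->
  (forall X, conn_ideal X -> P X) ->
  (forall X S, path_ideal X -> clopen X S ->
     P (split_ideal X S) -> P (split_ideal X (fun i j => ~~ S i j)) -> P X) ->
  forall X, path_ideal X -> P X.
Proof.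
move=> P0 P1 P2 X; have [m] := ubnP #|[set ij | X ij.1 ij.2]|.
elim: m X => // m IH X Xm idX.
have [[S [clS [[i j] [[i' j'] [/= Xij Xij' Sij Sij']]]]]|] :=
  boolp.pselect (exists S, clopen X S /\ exists p q : 'I_n * 'I_n,
    [/\ X p.1 p.2, X q.1 q.2, S p.1 p.2 & ~~ S q.1 q.2]).
  have proper (S' : rel 'I_n) p : X p.1 p.2 -> ~~ S' p.1 p.2 ->
      (#|[set ij | split_ideal X S' ij.1 ij.2]| < m)%N.
    move=> Xp Sp; apply: leq_trans (_ : #|[set ij | X ij.1 ij.2]| <= m)%N => //.
    apply/proper_card/properP; split; last by exists p; rewrite !inE /split_ideal ?Xp.
    by apply/subsetP => q; rewrite !inE => /andP[].
  apply: (P2 X S) => //; apply: IH.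
  - exact: (proper S (i', j')).
  - exact: split_path_ideal.
  - by apply: (proper _ (i, j)) => //=; rewrite negbK.
  - exact/split_path_ideal/clopenC.
move=> NS; have [[[i j] /= Xij]|Xn] := boolp.pselect (exists p, X p.1 p.2); last first.
  by apply: P0 => // i j; apply/negP => Xij; apply: Xn; exists (i, j).
apply: P1; split=> //; first by exists i, j.
move=> S clS a b c d Xab Xcd; apply/idP/idP => Sx; apply: contraT => Sn.
  by case: NS; exists S; split=> //; exists (a, b), (c, d).
by case: NS; exists S; split=> //; exists (c, d), (a, b).
Qed.

End Tree.

(** * The path algebra of an oriented tree *)

Section PathBasis.
Variables (k : closedFieldType) (n : nat) (e : rel 'I_n).
Hypothesis ht : oriented_tree e.
Local Notation A := (pathalg k e).
Local Notation le := (connect e).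
Implicit Types (x y z : A) (i j l a b : 'I_n) (X Y : rel 'I_n).

(** The choice is harmless, since by [qpath_inj] a path is determined by its ends. *)
Definition qpath_opt i j : option (qpath e) :=
  if pselect (exists p : qpath e, psource p = i /\ ptarget p = j) is left H
  then Some (sval (cid H)) else None.

Definition path_coef i j x : k := if qpath_opt i j is Some p then x@_p else 0.

Definition path_mon i j (c : k) : A := if qpath_opt i j is Some p then << c *g p >> else 0.

Lemma qpath_inj (p q : qpath e) : psource p = psource q -> ptarget p = ptarget q -> p = q.
Proof.
case: p q => [[i s] ps] [[j s'] ps']; rewrite /psource /ptarget /= => ij; subst j.
by move=> /(dpath_inj ht ps ps') /= ss; apply: val_inj => /=; rewrite ss.
Qed.

Lemma qpath_optE (p : qpath e) : qpath_opt (psource p) (ptarget p) = Some p.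
Proof.
rewrite /qpath_opt; case: pselect => [H|[]]; last by exists p.
by case: cid => q [? ?]; congr Some; apply: qpath_inj.
Qed.

Lemma qpath_optP i j : le i j ->
  exists p, [/\ qpath_opt i j = Some p, psource p = i & ptarget p = j].
Proof.
case/connectP=> s ps jE; pose p := QPath (ps : path e (i, s).1 (i, s).2).
have pj : ptarget p = j by rewrite jE.
by exists p; rewrite -pj; split=> //; exact: (qpath_optE p).
Qed.

Lemma qpath_le (p : qpath e) : le (psource p) (ptarget p).
Proof. by case: p => [[i s] /= ps]; apply/connectP; exists s. Qed.

Lemma qpath_optN i j : ~~ le i j -> qpath_opt i j = None.
Proof.
move=> ij; rewrite /qpath_opt; case: pselect => // H; exfalso.
by case: H => p [pi pj]; move: (qpath_le p); rewrite pi pj (negbTE ij).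
Qed.

Lemma path_coef0_le i j x : ~~ le i j -> path_coef i j x = 0.
Proof. by move=> ij; rewrite /path_coef qpath_optN. Qed.

Lemma path_coef_inj x y : (forall i j, path_coef i j x = path_coef i j y) -> x = y.
Proof.
move=> xy; apply/malgP => p; have := xy (psource p) (ptarget p).
by rewrite /path_coef qpath_optE.
Qed.

Lemma path_coefD i j x y : path_coef i j (x + y) = path_coef i j x + path_coef i j y.
Proof.
rewrite /path_coef; case: qpath_opt => [p|]; last by rewrite addr0.
exact: (mcoeffD p x y).
Qed.

Lemma path_coef_mon i j a b c :
  path_coef a b (path_mon i j c) = if [&& a == i, b == j & le i j] then c else 0.
Proof.
have [ij|ij] := boolP (le i j); last first.
  by rewrite !andbF /path_mon qpath_optN // /path_coef; case: qpath_opt => // p; exact: mcoeff0.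
have [p [pE <- <-]] := qpath_optP ij; rewrite /path_mon qpath_optE /path_coef andbT.
have [/qpath_optP[q [-> <- <-]]|ab] := boolP (le a b).
  rewrite [LHS](mcoeffU p c q) -mulrb; congr (c *+ nat_of_bool _).
  apply/eqP/andP => [-> //|[/eqP st /eqP tt]]; exact/esym/qpath_inj.
rewrite qpath_optN //; case: eqP => //= aE; case: eqP => //= bE.
by rewrite aE bE qpath_le in ab.
Qed.

Lemma path_monM i j l c d : le i j -> le j l ->
  path_mon j l c * path_mon i j d = path_mon i l (c * d).
Proof.
move=> ij jl; have [p [pE sp tp]] := qpath_optP ij; have [q [qE sq tq]] := qpath_optP jl.
rewrite /path_mon pE qE [LHS](pathmulUU q p c d) /pathmulU.
have [|r -> rE] := @pconcE _ _ q p; first by rewrite sq tp.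
have sr : psource r = i by rewrite /psource rE.
have tr : ptarget r = l.
  by rewrite /ptarget rE /= last_cat -/(ptarget p) tp -sq -/(ptarget q).
by rewrite -sr -tr qpath_optE.
Qed.

Lemma path_monM0 i j j' l c d : j != j' -> path_mon j' l c * path_mon i j d = 0.
Proof.
move=> jj; have [ij|ij] := boolP (le i j); last first.
  by rewrite {2}/path_mon qpath_optN //; exact: pathmulg0.
have [jl|jl] := boolP (le j' l); last first.
  by rewrite {1}/path_mon qpath_optN //; exact: pathmul0g.
have [p [pE sp tp]] := qpath_optP ij; have [q [qE sq tq]] := qpath_optP jl.
rewrite /path_mon pE qE [LHS](pathmulUU q p c d) /pathmulU pconcN //.
by rewrite sq tp (negbTE jj).
Qed.

Lemma path_mon1 : 1 = \sum_i path_mon i i 1 :> A.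
Proof.
apply: eq_bigr => i _; rewrite /path_mon.
have := qpath_optE (ptriv e i).
by rewrite /psource /ptarget /= => ->.
Qed.

End PathBasis.

(* A ring with the multiplication table of the incidence algebra of the
   preorder le, the element mon i j c being c times the path from i to j. *)
Record incidence_basis (k : fieldType) (n : nat) (le : rel 'I_n) (A : pzRingType) :
  Type := IncidenceBasis {
  coef : 'I_n -> 'I_n -> A -> k;
  mon : 'I_n -> 'I_n -> k -> A;
  coef_inj : forall x y, (forall i j, coef i j x = coef i j y) -> x = y;
  coefD : forall i j x y, coef i j (x + y) = coef i j x + coef i j y;
  coef_mon : forall i j a b c,
    coef a b (mon i j c) = if [&& a == i, b == j & le i j] then c else 0;
  coef0_le : forall i j x, ~~ le i j -> coef i j x = 0;
  monM : forall i j l c d, le i j -> le j l -> mon j l c * mon i j d = mon i l (c * d);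
  monM0 : forall i j j' l c d, j != j' -> mon j' l c * mon i j d = 0;
  mon1 : 1 = \sum_i mon i i 1 }.

Definition path_basis (k : closedFieldType) (n : nat) (e : rel 'I_n) (ht : oriented_tree e) :
    incidence_basis k (connect e) (pathalg k e) :=
  IncidenceBasis (path_coef_inj ht) (@path_coefD k n e) (path_coef_mon ht) (@path_coef0_le k n e)
    (path_monM ht) (path_monM0 ht) (path_mon1 k ht).

Arguments coef_inj {k n le A} i0 [x y].

Lemma sum_if_eq (V : nmodType) (I : finType) (i : I) (F : I -> V) :
  \sum_j (if j == i then F j else 0) = F i.
Proof. by rewrite -big_mkcond big_pred1_eq. Qed.

(** * Coefficients, ideals and bimodule endomorphisms of the incidence algebra *)

Section IncidenceAlgebra.
Variables (k : fieldType) (n : nat) (e : rel 'I_n) (A : pzRingType).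
Local Notation le := (connect e).
Variable B : incidence_basis k le A.
Local Notation coef := (coef B).
Local Notation mon := (mon B).
Implicit Types (x y z : A) (i j l a b : 'I_n) (X Y : rel 'I_n).

Lemma coef_le i j x : coef i j x != 0 -> le i j.
Proof. by apply: contraNT => /(coef0_le B)->. Qed.

Lemma coef0 i j : coef i j 0 = 0.
Proof. by apply: (addrI (coef i j 0)); rewrite -coefD !addr0. Qed.

Lemma coef_sum i j (I : Type) (r : seq I) (P : pred I) (F : I -> A) :
  coef i j (\sum_(u <- r | P u) F u) = \sum_(u <- r | P u) coef i j (F u).
Proof. exact: (big_morph (coef i j) (coefD B i j) (coef0 i j)). Qed.

Lemma monD i j c d : mon i j (c + d) = mon i j c + mon i j d.
Proof.
by apply: (coef_inj B) => a b; rewrite coefD !coef_mon; case: ifP => //; rewrite addr0.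
Qed.

Lemma mon0 i j : mon i j 0 = 0.
Proof. by apply: (addrI (mon i j 0)); rewrite -monD !addr0. Qed.

Lemma coef_msum a b (c : 'I_n -> 'I_n -> k) :
  coef a b (\sum_i \sum_j mon i j (c i j)) = if le a b then c a b else 0.
Proof.
rewrite coef_sum (eq_bigr (fun i => if i == a then coef a b (\sum_j mon a j (c a j)) else 0)).
  rewrite sum_if_eq coef_sum.
  rewrite (eq_bigr (fun j => if j == b then if le a b then c a b else 0 else 0)).
    by rewrite sum_if_eq.
  by move=> j _; rewrite coef_mon eqxx eq_sym /=; case: eqP => //= ->.
move=> i _; rewrite coef_sum; case: eqP => [->|/eqP ia]; first by rewrite coef_sum.
by rewrite big1 // => j _; rewrite coef_mon eq_sym (negbTE ia).
Qed.

Lemma msum_coef x : x = \sum_i \sum_j mon i j (coef i j x).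
Proof.
apply: (coef_inj B) => a b; rewrite coef_msum.
by case: ifP => // /negbT /(coef0_le B).
Qed.

Lemma coefM i l x y : coef i l (x * y) = \sum_j coef j l x * coef i j y.
Proof.
(* In the fourfold expansion only d = a, b = l, c = i can contribute; where a path is missing, its
   coefficient is zero by [coef0_le]. *)
have T a b c d : coef i l (mon a b (coef a b x) * mon c d (coef c d y)) =
    if b == l then if c == i then if d == a then coef a l x * coef i a y else 0 else 0 else 0.
  have [<-|da] := eqVneq d a; last by rewrite monM0 // coef0; do 2 case: ifP => //.
  have [cd|/[dup]ncd /(coef0_le B) ->] := boolP (le c d); last first.
    rewrite mon0 mulr0 coef0; do 2 case: ifP => //.
    by move=> /eqP <-; rewrite (coef0_le B _ ncd) mulr0.
  have [db|/[dup]ndb /(coef0_le B) ->] := boolP (le d b); last first.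
    rewrite mon0 mul0r coef0; case: ifP => // /eqP <-.
    by rewrite (coef0_le B _ ndb) mul0r; case: ifP.
  rewrite monM // coef_mon (connect_trans cd db) andbT andbC eq_sym.
  by case: eqP => //= ->; rewrite eq_sym; case: eqP => //= ->.
rewrite {1}(msum_coef x) {1}(msum_coef y) mulr_suml coef_sum; apply: eq_bigr => a _.
rewrite mulr_suml coef_sum.
rewrite (eq_bigr (fun b => if b == l then coef a l x * coef i a y else 0)) ?sum_if_eq // => b _.
rewrite mulr_sumr coef_sum.
rewrite (eq_bigr (fun c => if c == i then if b == l then coef a l x * coef i a y else 0 else 0))
  ?sum_if_eq // => c _.
rewrite mulr_sumr coef_sum.
rewrite (eq_bigr (fun d => if d == a then if b == l then if c == i then coef a l x * coef i a y else 0 else 0 else 0)).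
  by rewrite sum_if_eq; do 2 case: ifP => //.
by move=> d _; rewrite T; do 3 case: ifP => //.
Qed.

Lemma coef_monl i l j b c x : coef i l (mon j b c * x) =
  if (b == l) && le j b then c * coef i j x else 0.
Proof.
rewrite coefM (eq_bigr (fun a => if a == j then if (b == l) && le j b then c * coef i j x else 0 else 0))
  ?sum_if_eq // => a _.
rewrite coef_mon [l == b]eq_sym; case: (eqVneq a j) => [->|] /=; last by rewrite mul0r.
by case: ifP => //; rewrite mul0r.
Qed.

Lemma coef_monr i l a j c x : coef i l (x * mon a j c) =
  if (a == i) && le a j then coef j l x * c else 0.
Proof.
rewrite coefM (eq_bigr (fun d => if d == j then if (a == i) && le a j then coef j l x * c else 0 else 0))
  ?sum_if_eq // => d _.
rewrite coef_mon [i == a]eq_sym; case: (eqVneq d j) => [->|] /=; last by rewrite andbF mulr0.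
by case: ifP => //; rewrite mulr0.
Qed.

Lemma mon_mul_sum j l c x : le j l -> mon j l c * x = \sum_i mon i l (c * coef i j x).
Proof.
move=> jl; apply: (coef_inj B) => a b; rewrite coef_monl jl andbT coef_sum.
rewrite (eq_bigr (fun i => if i == a then if l == b then c * coef a j x else 0 else 0))
  ?sum_if_eq // => i _.
rewrite coef_mon [a == i]eq_sym; case: (eqVneq i a) => //= ->.
rewrite [b == l]eq_sym; case: (eqVneq l b) => //= _.
case: ifP => // al; have [aj|/(coef0_le B)->] := boolP (le a j); last by rewrite mulr0.
by rewrite (connect_trans aj jl) in al.
Qed.

Lemma mul_mon_sum i j c x : le i j -> x * mon i j c = \sum_l mon i l (coef j l x * c).
Proof.
move=> ij; apply: (coef_inj B) => a b; rewrite coef_monr ij andbT coef_sum.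
rewrite (eq_bigr (fun l => if l == b then if i == a then coef j b x * c else 0 else 0))
  ?sum_if_eq // => l _.
rewrite coef_mon [b == l]eq_sym [a == i]eq_sym; case: (eqVneq l b) => [->|]; last by rewrite andbF.
case: (eqVneq i a) => //= _.
case: ifP => // il; have [jb|/(coef0_le B)->] := boolP (le j b); last by rewrite mul0r.
by rewrite (connect_trans ij jb) in il.
Qed.

Definition span_ideal X (x : A) : Prop := forall i j, coef i j x != 0 -> X i j.

Lemma span_coef0 X x i j : span_ideal X x -> ~~ X i j -> coef i j x = 0.
Proof. by move=> Xx; apply: contraNeq => /Xx. Qed.

Lemma span_mon X i j c : X i j -> span_ideal X (mon i j c).
Proof.
by move=> Xij a b; rewrite coef_mon; case: ifP => [/and3P[/eqP-> /eqP->]|]; rewrite ?eqxx.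
Qed.

Lemma span_sum X (I : Type) (r : seq I) (P : pred I) (F : I -> A) :
  (forall u, P u -> span_ideal X (F u)) -> span_ideal X (\sum_(u <- r | P u) F u).
Proof.
move=> XF i j; rewrite coef_sum; apply: contraNT => Xij; rewrite big1 // => u /XF XFu.
exact: span_coef0 XFu Xij.
Qed.

Lemma span_ideal_two_sided X : path_ideal e X -> two_sided_ideal (span_ideal X).
Proof.
move=> [Xle Xid]; split=> [i j|x y Xx Xy i j|a x Xx i l|a x Xx i l].
- by rewrite coef0 eqxx.
- by rewrite coefD; apply: contraNT => Xij; rewrite !(@span_coef0 X) ?addr0.
- rewrite coefM; apply: contraNT => Xil; rewrite big1 // => j _.
  have [Xij|Xij] := boolP (X i j); last by rewrite (span_coef0 Xx Xij) mulr0.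
  have [jl|/(coef0_le B)->] := boolP (le j l); last by rewrite mul0r.
  by rewrite (Xid i i j l) ?connect0 in Xil.
- rewrite coefM; apply: contraNT => Xil; rewrite big1 // => j _.
  have [Xij|Xij] := boolP (X j l); last by rewrite (span_coef0 Xx Xij) mul0r.
  have [ij|/(coef0_le B)->] := boolP (le i j); last by rewrite mulr0.
  by rewrite (Xid i j l l) ?connect0 in Xil.
Qed.

(** The space of elements from vertex i to vertex l is at most one-dimensional; cutting down by the
    two vertex idempotents isolates a coefficient. *)
Lemma sandwich i l x : mon l l 1 * x * mon i i 1 = mon i l (coef i l x).
Proof.
apply: (coef_inj B) => a b; rewrite coef_monr connect0 andbT coef_monl connect0 andbT.
rewrite mul1r mulr1 coef_mon.
rewrite [a == i]eq_sym [b == l]eq_sym; case: (eqVneq i a) => [->|//] /=.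
case: (eqVneq l b) => [->|//] /=.
by case: ifP => // /negbT /(coef0_le B).
Qed.

(** By [sandwich], an ideal contains each monomial of each of its elements, and the nonzero
    coefficient can be inverted. So [X] collects the paths in [I]. *)
Lemma two_sided_span (I : A -> Prop) : two_sided_ideal I ->
  exists2 X, path_ideal e X & I = span_ideal X.
Proof.
move=> [I0 ID Il Ir]; pose X i j := le i j && `[< I (mon i j 1) >].
exists X.
  split=> [i j /andP[]//|a i j b ai /andP[ij /asboolP Iij] jb].
  apply/andP; split; first exact: connect_trans ai (connect_trans ij jb).
  apply/asboolP; have -> : mon a b 1 = mon j b 1 * mon i j 1 * mon a i 1.
    by rewrite !monM ?mulr1 //; exact: connect_trans ij jb.
  exact/Ir/Il.
apply/funext => x; apply/propext; split=> [Ix i j xij|Xx].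
  have ij := coef_le xij; apply/andP; split=> //; apply/asboolP.
  have -> : mon i j 1 = mon j j (coef i j x)^-1 * (mon j j 1 * x * mon i i 1).
    by rewrite sandwich monM // mulVf.
  exact/Il/Ir/Il.
rewrite (msum_coef x); elim/big_ind: _ => // i _; elim/big_ind: _ => // j _.
have [->|/Xx /andP[ij /asboolP Iij]] := eqVneq (coef i j x) 0; first by rewrite mon0.
have -> : mon i j (coef i j x) = mon j j (coef i j x) * mon i j 1 by rewrite monM // mulr1.
exact: Il.
Qed.

Definition diag (c : 'I_n -> 'I_n -> k) x : A := \sum_i \sum_j mon i j (c i j * coef i j x).

Lemma coef_diag c i j x : coef i j (diag c x) = c i j * coef i j x.
Proof.
rewrite /diag coef_msum; case: ifP => // /negbT /(coef0_le B)->.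
by rewrite mulr0.
Qed.

Lemma diag_is_zmod_morphism c : zmod_morphism (diag c).
Proof.
move=> x y; apply: (addIr (diag c y)); rewrite subrK; apply: (coef_inj B) => i j.
by rewrite coefD !coef_diag -mulrDr -coefD subrK.
Qed.

Lemma diag_bimod_endo X (c : 'I_n -> 'I_n -> k) : path_ideal e X ->
  (forall a i j b, le a i -> X i j -> le j b -> c i j = c a b) ->
  bimod_endo (span_ideal X) (diag c).
Proof.
move=> [Xle Xid] cE; split=> [x Xx i j|x y _ _|a x Xx|x a Xx].
- by rewrite coef_diag mulf_eq0 negb_or => /andP[_ /Xx].
- by apply: (coef_inj B) => i j; rewrite coefD !coef_diag coefD mulrDr.
- apply: (coef_inj B) => i l; rewrite coef_diag !coefM mulr_sumr; apply: eq_bigr => j _.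
  rewrite coef_diag mulrCA.
  have [Xij|Xij] := boolP (X i j); last by rewrite (span_coef0 Xx Xij) !mulr0.
  have [jl|/(coef0_le B)->] := boolP (le j l); last by rewrite !mul0r.
  by rewrite (cE i i j l).
- apply: (coef_inj B) => i l; rewrite coef_diag !coefM mulr_sumr; apply: eq_bigr => j _.
  rewrite coef_diag mulrA.
  have [Xij|Xij] := boolP (X j l); last by rewrite (span_coef0 Xx Xij) !mulr0 !mul0r.
  have [ij|/(coef0_le B)->] := boolP (le i j); last by rewrite !mulr0.
  by rewrite (cE i j l l).
Qed.

(** Commuting with vertex idempotents, [f] scales each path; commuting with multiplication by paths,
    it has the same scalar on a path and on its extensions. *)
Lemma bimod_endo_diag X f : path_ideal e X -> bimod_endo (span_ideal X) f ->
  exists2 c : 'I_n -> 'I_n -> k,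
    forall a i j b, le a i -> X i j -> le j b -> c i j = c a b &
    forall x, span_ideal X x -> f x = diag c x.
Proof.
move=> [Xle Xid] [fI fD fl fr]; pose c i j := coef i j (f (mon i j 1)).
have fm i j d : X i j -> f (mon i j d) = mon i j (c i j * d).
  move=> Xij; have ij := Xle _ _ Xij.
  (* Only A-linearity of [f] is at hand, so the scalar d is written as left multiplication by
     [mon j j d]. *)
  have -> : mon i j d = mon j j d * (mon j j 1 * mon i j 1 * mon i i 1).
    by rewrite !monM // !mulr1.
  have Xm : span_ideal X (mon i j 1) by exact: span_mon.
  have [_ _ Il Ir] := span_ideal_two_sided (conj Xle Xid).
  rewrite fl; last exact/Ir/Il.
  rewrite [f (_ * mon i i 1)]fr; last exact: Il.
  by rewrite fl // sandwich monM // mulrC.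
exists c.
  move=> a i j b ai Xij jb; have ij := Xle _ _ Xij.
  have Xab := Xid _ _ _ _ ai Xij jb.
  have Xm : span_ideal X (mon i j 1) by exact: span_mon.
  have [_ _ Il Ir] := span_ideal_two_sided (conj Xle Xid).
  have : f (mon j b 1 * mon i j 1 * mon a i 1) = mon j b 1 * f (mon i j 1) * mon a i 1.
    by rewrite [LHS]fr; [rewrite fl|exact: Il].
  rewrite (monM B) // (monM B) ?(connect_trans ij jb) // !mulr1 !fm //.
  rewrite (monM B) // (monM B) ?(connect_trans ij jb) // !mulr1 mul1r.
  by move/(congr1 (coef a b)); rewrite !coef_mon !eqxx (Xle _ _ Xab) /= => ->.
move=> x Xx; have [I0 ID _ _] := span_ideal_two_sided (conj Xle Xid).
have f0 : f 0 = 0 by apply: (addrI (f 0)); rewrite -fD // !addr0.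
have fsum (I : Type) (r : seq I) (F : I -> A) : (forall u, span_ideal X (F u)) ->
    f (\sum_(u <- r) F u) = \sum_(u <- r) f (F u).
  move=> XF; elim: r => [|u r IH]; first by rewrite !big_nil.
  by rewrite !big_cons fD ?IH //; exact: span_sum.
have Xm i j : span_ideal X (mon i j (coef i j x)).
  have [->|/Xx Xij] := eqVneq (coef i j x) 0; [by rewrite mon0 | exact: span_mon].
rewrite {1}(msum_coef x) fsum => [|i]; last exact: span_sum.
apply: eq_bigr => i _; rewrite fsum //; apply: eq_bigr => j _.
have [->|/Xx Xij] := eqVneq (coef i j x) 0; last exact: fm.
by rewrite mulr0 mon0.
Qed.

Lemma span_brick X F : conn_ideal e X -> dual_projection (span_ideal X) F ->
  @brick (funcat _ _) F.
Proof.
move=> [idX [i0 [j0 Xij0]] Xconn] dpF; have [Xle Xid] := idX.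
(* The coordinate projection of [A] onto the span of [X] is the additive retraction required by
   [dual_projection_brick]. *)
pose ex := pack_additive (diag_is_zmod_morphism (fun i j => (X i j)%:R)).
apply: (dual_projection_brick (e := ex)) dpF _ _ _ _.
- exact: span_ideal_two_sided.
- by move=> x i j; rewrite /= coef_diag; case: (X i j) => //; rewrite mul0r eqxx.
- move=> x Xx; apply: (coef_inj B) => i j; rewrite /= coef_diag.
  by have [|/(span_coef0 Xx)->] := boolP (X i j); rewrite ?mul1r ?mulr0.
- exists (mon i0 j0 1); first exact: span_mon.
  move/(congr1 (coef i0 j0)); rewrite coef_mon !eqxx Xle // coef0 => /eqP.
  by rewrite oner_eq0.
move=> f /(bimod_endo_diag idX)[c cE fE].
have cX i j : X i j -> c i j = c i0 j0.
  (* The level set of the scalars through (i0, j0) is clopen, so connectedness makes the scalars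
     constant on [X]. *)
  move=> Xij; have clS : clopen e X (fun i j => c i j == c i0 j0).
    by move=> a i' j' b ai Xij' jb; rewrite (cE a i' j' b).
  by apply/eqP; rewrite (Xconn _ clS i j i0 j0).
have [c0|c0] := eqVneq (c i0 j0) 0; [left|right].
  move=> x Xx; rewrite fE //; apply: (coef_inj B) => i j; rewrite coef_diag coef0.
  by have [/cX->|/(span_coef0 Xx)->] := boolP (X i j); rewrite ?c0 ?mul0r ?mulr0.
exists (diag (fun _ _ => (c i0 j0)^-1)); first exact: diag_bimod_endo.
move=> x Xx; have [gI _ _ _] :=
  @diag_bimod_endo X (fun _ _ => (c i0 j0)^-1) idX (fun _ _ _ _ _ _ _ => erefl).
rewrite !fE //; last exact: gI.
split; apply: (coef_inj B) => i j; rewrite !coef_diag.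
  have [/cX->|/(span_coef0 Xx)->] := boolP (X i j); last by rewrite !mulr0.
  by rewrite mulrA mulfV // mul1r.
have [/cX->|/(span_coef0 Xx)->] := boolP (X i j); last by rewrite !mulr0.
by rewrite mulrA mulVf // mul1r.
Qed.
End IncidenceAlgebra.

Section SpanIdeals.
Variables (k : fieldType) (n : nat) (e : rel 'I_n) (A : pzRingType).
Local Notation le := (connect e).
Variable B : incidence_basis k le A.
Local Notation coef := (coef B).
Local Notation mon := (mon B).
Implicit Types (a x y z : A) (i j l : 'I_n) (X Y : rel 'I_n).
Local Notation span_ideal := (span_ideal B).

(** * Composites of dual projection functors *)

Section Composition.
Hypothesis ht : oriented_tree e.
Variables (X Y : rel 'I_n) (idX : path_ideal e X) (idY : path_ideal e Y).
Variables F G : functor (fgmod_cat A) (fgmod_cat A).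
Variables (t : forall M : fgmod A, A -> M -> (F M : fgmod A))
  (t' : forall M : fgmod A, A -> M -> (G M : fgmod A)).
Arguments t M : clear implicits.
Arguments t' M : clear implicits.
Hypotheses (tF : is_dual_projection (span_ideal X) t) (tG : is_dual_projection (span_ideal Y) t').
Let Z := prod_ideal X Y.

Let Xl i j l : X i j -> le j l -> X i l.
Proof. by move=> Xij; case: idX => _ /(_ i i j l); apply. Qed.
Let Yr i j l : le i j -> Y j l -> Y i l.
Proof. by move=> ij Yjl; case: idY => _ /(_ i j l l); apply. Qed.
Let Xle i j : X i j -> le i j. Proof. by case: idX => + _; apply. Qed.
Let Yle i j : Y i j -> le i j. Proof. by case: idY => + _; apply. Qed.
Let spX : two_sided_ideal (span_ideal X). Proof. exact: span_ideal_two_sided. Qed.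
Let spY : two_sided_ideal (span_ideal Y). Proof. exact: span_ideal_two_sided. Qed.
Let X0 : span_ideal X 0. Proof. by case: spX. Qed.
Let Y0 : span_ideal Y 0. Proof. by case: spY. Qed.
Let tT (M : fgmod A) : is_tensor (span_ideal X) (t M). Proof. by case: tF. Qed.
Let tT' (M : fgmod A) : is_tensor (span_ideal Y) (t' M). Proof. by case: tG. Qed.
Let tl (M : fgmod A) a x (m : M) : span_ideal X x -> t M (a * x) m = a *: t M x m.
Proof. by case: tF => _ + _; apply. Qed.
Let tl' (M : fgmod A) a x (m : M) : span_ideal Y x -> t' M (a * x) m = a *: t' M x m.
Proof. by case: tG => _ + _; apply. Qed.

Let mid i l := odflt i [pick j | Y i j && X j l].

Let midP i l : Z i l -> Y i (mid i l) /\ X (mid i l) l.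
Proof.
case/existsP=> j Yj; rewrite /mid; case: pickP => [j' /andP[]//|/(_ j)].
by rewrite Yj.
Qed.

(* The path i -> l factors as a path of X after a path of Y; which
   factorization is used does not matter, by balancedness. *)
Let u (M : fgmod A) i l (c : k) (m : M) : (F (G M : fgmod A) : fgmod A) :=
  if Z i l then t (G M) (mon (mid i l) l c) (t' M (mon i (mid i l) 1) m) else 0.

(** Two middle vertices are comparable by [interval_chain], and the path between them moves across
    the tensor sign from the [X] factor to the [Y] factor. *)
Let uE (M : fgmod A) i j l c (m : M) : Y i j -> X j l ->
  u i l c m = t (G M) (mon j l c) (t' M (mon i j 1) m).
Proof.
have indep j1 j2 : Y i j1 -> X j1 l -> Y i j2 -> X j2 l -> le j1 j2 ->
    t (G M) (mon j1 l c) (t' M (mon i j1 1) m) = t (G M) (mon j2 l c) (t' M (mon i j2 1) m).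
  move=> Y1 X1 Y2 X2 j12.
  rewrite -[c]mulr1 -(monM B c 1 j12 (Xle X2)) (tensorA (tT _)); last exact: span_mon.
  by rewrite -tl' ?(monM B) ?mulr1 //; [exact: Yle | exact: span_mon].
move=> Yij Xjl; have Zil : Z i l by apply/existsP; exists j; rewrite Yij.
rewrite /u Zil; have [Ym Xm] := midP Zil.
have [jm|mj] := interval_chain ht (Yle Yij) (Xle Xjl) (Yle Ym) (Xle Xm).
  exact/esym/indep.
exact: indep.
Qed.

Let u0 (M : fgmod A) i l (m : M) : u i l 0 m = 0.
Proof. by rewrite /u; case: ifP => // _; rewrite mon0 (tensor0l (tT _)). Qed.

Let uN (M : fgmod A) i l c (m : M) : ~~ Z i l -> u i l c m = 0.
Proof. by rewrite /u; case: ifP. Qed.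

Let uD (M : fgmod A) i l c d (m : M) : u i l (c + d) m = u i l c m + u i l d m.
Proof.
rewrite /u; case: ifP => [/midP[Ym Xm]|_]; last by rewrite addr0.
by rewrite monD (tensorDl (tT _)) //; exact: span_mon.
Qed.

Let u_sum (M : fgmod A) i l (c : 'I_n -> k) (m : M) :
  u i l (\sum_j c j) m = \sum_j u i l (c j) m.
Proof. exact: (big_morph (fun c => u i l c m) (fun _ _ => uD _ _ _ _ _) (u0 _ _ _)). Qed.

Let uDr (M : fgmod A) i l c (m m' : M) : u i l c (m + m') = u i l c m + u i l c m'.
Proof.
rewrite /u; case: ifP => [/midP[Ym Xm]|_]; last by rewrite addr0.
by rewrite (tensorDr (tT' _)) ?(tensorDr (tT _)) //; exact: span_mon.
Qed.

(** The scalar d is moved to the left factor as the multiple [mon h h d] of the vertex idempotent at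
    h. *)
Let slide (M : fgmod A) i h l c d (m : M) : Y i h -> X h l ->
  t (G M) (mon h l c) (t' M (mon i h d) m) = u i l (c * d) m.
Proof.
move=> Yih Xhl; rewrite (uE _ _ Yih Xhl).
have -> : mon i h d = mon h h d * mon i h 1 by rewrite monM ?mulr1 //; exact: Yle.
rewrite tl'; last exact: span_mon.
rewrite -(tensorA (tT _)); last exact: span_mon.
by rewrite monM //; exact: Xle.
Qed.

(** This realizes the pure tensor of z in the product ideal with m inside [F (G M)]. *)
Let tens (M : fgmod A) z (m : M) := \sum_i \sum_l u i l (coef i l z) m.

Let tens_l (M : fgmod A) a z (m : M) : span_ideal Z z -> tens (a * z) m = a *: tens z m.
Proof.
move=> Zz; rewrite /tens scaler_sumr; apply: eq_bigr => i _.
rewrite scaler_sumr; under eq_bigr do rewrite coefM u_sum.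
rewrite exchange_big; apply: eq_bigr => h _ /=.
have [Zih|Zih] := boolP (Z i h); last first.
  rewrite (span_coef0 Zz Zih) u0 scaler0 big1 // => l _.
  by rewrite mulr0 u0.
have [Ym Xm] := midP Zih; rewrite (uE _ _ Ym Xm) -tl; last exact: span_mon.
rewrite mul_mon_sum; last exact: Xle.
have Xml l : span_ideal X (mon (mid i h) l (coef h l a * coef i h z)).
  have [hl|/(coef0_le B)->] := boolP (le h l); last by rewrite mul0r mon0.
  exact/span_mon/(Xl Xm).
rewrite (tensor_suml (tT _)) //; apply: eq_bigr => l _.
have [hl|/(coef0_le B)->] := boolP (le h l).
  by rewrite slide ?mulr1 //; exact: Xl Xm hl.
by rewrite mul0r u0 mon0 (tensor0l (tT _)).
Qed.

Let act_r (M : fgmod A) j h l c a (m : M) : Y j h -> X h l ->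
  t (G M) (mon h l c) (t' M (mon j h 1 * a) m) = \sum_i u i l (c * coef i j a) m.
Proof.
move=> Yjh Xhl; rewrite mon_mul_sum; last exact: Yle.
have Ymi i : span_ideal Y (mon i h (1 * coef i j a)).
  have [ij|/(coef0_le B)->] := boolP (le i j); last by rewrite mulr0 mon0.
  exact/span_mon/(Yr ij).
rewrite (tensor_suml (tT' _)) // (tensor_sumr (tT _)); last exact: span_mon.
apply: eq_bigr => i _; rewrite mul1r.
have [ij|/(coef0_le B)->] := boolP (le i j).
  by rewrite slide //; exact: Yr ij Yjh.
by rewrite mulr0 u0 mon0 (tensor0l (tT' _)) // (tensor0r (tT _)) //; exact: span_mon.
Qed.

Let tens_r (M : fgmod A) a z (m : M) : span_ideal Z z -> tens (z * a) m = tens z (a *: m).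
Proof.
move=> Zz; rewrite /tens [LHS]exchange_big [RHS]exchange_big; apply: eq_bigr => l _ /=.
under eq_bigr do rewrite coefM u_sum.
rewrite exchange_big; apply: eq_bigr => j _ /=.
have [Zjl|Zjl] := boolP (Z j l); last first.
  by rewrite (span_coef0 Zz Zjl) u0 big1 // => i _; rewrite mul0r u0.
have [Ym Xm] := midP Zjl; rewrite (uE _ _ Ym Xm) -(tensorA (tT' _)); last exact: span_mon.
exact/esym/act_r.
Qed.

(** Under the identification, xy ⊗ m is x ⊗ (y ⊗ m). This is what yields uniqueness in the universal
    property of the composite. *)
Let tens_tens (M : fgmod A) x y (m : M) : span_ideal X x -> span_ideal Y y ->
  tens (x * y) m = t (G M) x (t' M y m).
Proof.
move=> Xx Yy; have Xm j l : span_ideal X (mon j l (coef j l x)).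
  have [->|/Xx Xjl] := eqVneq (coef j l x) 0; [by rewrite mon0 | exact: span_mon].
have -> : tens (x * y) m = \sum_j \sum_l \sum_i u i l (coef j l x * coef i j y) m.
  rewrite exchange_big [LHS]exchange_big; apply: eq_bigr => l _ /=.
  rewrite exchange_big; apply: eq_bigr => i _ /=.
  by rewrite coefM u_sum.
rewrite [x in RHS](msum_coef B) (tensor_suml (tT _)) => [|//|j]; last exact: span_sum.
apply: eq_bigr => j _; rewrite (tensor_suml (tT _)) //; apply: eq_bigr => l _.
have [Xjl|Xjl] := boolP (X j l); last first.
  rewrite (span_coef0 Xx Xjl) mon0 (tensor0l (tT _)) // big1 // => i _.
  by rewrite mul0r u0.
have -> : mon j l (coef j l x) = mon j l (coef j l x) * mon j j 1.
  by rewrite monM ?mulr1 //; exact: Xle.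
rewrite (tensorA (tT _)) // -tl' //.
rewrite mon_mul_sum // (tensor_suml (tT' _)) // => [|i]; last first.
  rewrite mul1r; have [->|/Yy Yij] := eqVneq (coef i j y) 0; [by rewrite mon0 | exact: span_mon].
rewrite (tensor_sumr (tT _)) //; apply: eq_bigr => i _; rewrite mul1r.
have [Yij|Yij] := boolP (Y i j); first by rewrite slide.
by rewrite (span_coef0 Yy Yij) mulr0 u0 mon0 (tensor0l (tT' _)) // (tensor0r (tT _)).
Qed.

Let tens_balanced (M : fgmod A) : balanced (span_ideal Z) (@tens M).
Proof.
split=> [x y m _ _|x m m' _|z a m]; last exact: tens_r.
  rewrite /tens -big_split; apply: eq_bigr => i _; rewrite -big_split; apply: eq_bigr => l _.
  by rewrite coefD uD.
rewrite /tens -big_split; apply: eq_bigr => i _; rewrite -big_split; apply: eq_bigr => l _.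
exact: uDr.
Qed.

Let span_prod x y : span_ideal X x -> span_ideal Y y -> span_ideal Z (x * y).
Proof.
move=> Xx Yy i l; rewrite coefM; apply: contraNT => Zil; rewrite big1 // => j _.
have [Yij|Yij] := boolP (Y i j); last by rewrite (span_coef0 Yy Yij) mulr0.
have [Xjl|Xjl] := boolP (X j l); last by rewrite (span_coef0 Xx Xjl) mul0r.
by case/existsP: Zil; exists j; rewrite Yij.
Qed.

(** The map b (xy) m is lifted twice: in (y, m) for fixed x, through [G M], and then in x, through
    [F (G M)]. *)
Let tens_lift (M : fgmod A) (W : zmodType) (b : A -> M -> W) : balanced (span_ideal Z) b ->
  exists h : {additive (F (G M : fgmod A) : fgmod A) -> W},
    forall x y m, span_ideal X x -> span_ideal Y y -> h (t (G M) x (t' M y m)) = b (x * y) m.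
Proof.
move=> [bDl bDr bA]; case: (spX) (spY) => _ XD Xleft Xright [_ YD Yleft Yright].
have ex x : exists h : {additive (G M : fgmod A) -> W}, span_ideal X x ->
    forall y m, span_ideal Y y -> h (t' M y m) = b (x * y) m.
  (* Outside the ideal the zero map is taken, so that a lift can be chosen for every x. *)
  have [Xx|nX] := pselect (span_ideal X x); last first.
    have zB : zmod_morphism (fun _ : (G M : fgmod A) => 0 : W) by move=> *; rewrite subr0.
    by exists (pack_additive zB) => /nX.
  have bx : balanced (span_ideal Y) (fun y m => b (x * y) m).
    split=> [y y' m Yy Yy'|y m m' Yy|y a m Yy].
    - by rewrite mulrDr bDl //; exact: span_prod.
    - by rewrite bDr //; exact: span_prod.
    - by rewrite mulrA bA //; exact: span_prod.
  by have [h hE] := tensor_lift (tT' M) bx; exists h.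
pose hx x := sval (cid (ex x)).
have hxE x y m : span_ideal X x -> span_ideal Y y -> hx x (t' M y m) = b (x * y) m.
  by move=> Xx; apply: (svalP (cid (ex x))).
have hB : balanced (span_ideal X) (fun x w => hx x w).
  split=> [x x' w Xx Xx'|x w w' _|x a w Xx].
  - have sB : zmod_morphism (fun w => hx x w + hx x' w).
      by move=> v v'; rewrite !raddfB opprD addrACA.
    apply: (tensor_ext (h := hx (x + x')) (h' := pack_additive sB) (tT' M)) => y m Yy /=.
    by rewrite !hxE ?mulrDl ?bDl //; [exact: span_prod..|exact: XD].
  - exact: raddfD.
  - have sB : zmod_morphism (fun w => hx x (a *: w)) by move=> v v'; rewrite scalerBr raddfB.
    apply: (tensor_ext (h := hx (x * a)) (h' := pack_additive sB) (tT' M)) => y m Yy /=.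
    by rewrite -tl' // !hxE ?mulrA //; [exact: Xright|exact: Yleft].
have [h hE] := tensor_lift (tT (G M)) hB.
by exists h => x y m Xx Yy; rewrite hE // hxE.
Qed.

Lemma tens_dual_projection :
  dual_projection (span_ideal (prod_ideal X Y)) (compF F G).
Proof.
exists (fun M z m => tens z m : (compF F G M : fgmod A)).
split=> [M|M a z m Zz|M N f z m Zz]; last 2 first.
- exact: tens_l.
- change (fmap_lin F (fmap_lin G f) (tens z m) = tens z (f m)).
  rewrite /tens linear_sum; apply: eq_bigr => i _; rewrite linear_sum; apply: eq_bigr => l _.
  rewrite /u; case: ifP => [/midP[Ym Xm]|_]; last exact: linear0.
  case: tF => _ _ tN; case: tG => _ _ tN'.
  rewrite [LHS](tN (G M) (G N) (fmap_lin G f)); last exact: span_mon.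
  by congr t; apply: tN'; exact: span_mon.
split; first exact: tens_balanced.
move=> W b bB; have [h hE] := tens_lift bB; have [bDl _ _] := bB.
have [Z0 ZD _ _] : two_sided_ideal (span_ideal Z).
  exact/span_ideal_two_sided/prod_path_ideal.
have b0 m : b 0 m = 0 by apply: (addrI (b 0 m)); rewrite -bDl // !addr0.
have bsum (f : 'I_n -> A) m : (forall i, span_ideal Z (f i)) ->
    b (\sum_i f i) m = \sum_i b (f i) m.
  move=> Zf; suff [] : span_ideal Z (\sum_i f i) /\ b (\sum_i f i) m = \sum_i b (f i) m by [].
  elim/big_ind2: _ => [|x1 v1 x2 v2 [Z1 <-] [Z2 <-]|i _]; split=> //; first exact: ZD.
  exact: bDl.
exists h; split=> [z m Zz|h' h'E w].
  have Zm i l : span_ideal Z (mon i l (coef i l z)).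
    have [->|/Zz Zil] := eqVneq (coef i l z) 0; [by rewrite mon0 | exact: span_mon].
  rewrite [z in RHS](msum_coef B) bsum => [|i]; last exact: span_sum.
  rewrite /tens raddf_sum; apply: eq_bigr => i _; rewrite bsum // raddf_sum; apply: eq_bigr => l _.
  have [Zil|Zil] := boolP (Z i l); last first.
    by rewrite (span_coef0 Zz Zil) u0 mon0 raddf0 b0.
  have [Ym Xm] := midP Zil; rewrite (uE _ _ Ym Xm) hE; [|exact: span_mon..].
  by rewrite monM ?mulr1 //; [exact: Yle | exact: Xle].
apply: (tensor_ext (h := h') (h' := h) (tT (G M))) => x v Xx.
have h1B : zmod_morphism (fun v => h' (t (G M) x v)).
  move=> v1 v2; apply: (addIr (h' (t (G M) x v2))).
  by rewrite -raddfD -(tensorDr (tT _)) // !subrK.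
have h2B : zmod_morphism (fun v => h (t (G M) x v)).
  move=> v1 v2; apply: (addIr (h (t (G M) x v2))).
  by rewrite -raddfD -(tensorDr (tT _)) // !subrK.
apply: (tensor_ext (h := pack_additive h1B) (h' := pack_additive h2B) (tT' M)) => y m Yy /=.
by rewrite hE // -tens_tens // h'E //; exact: span_prod.
Qed.

End Composition.

Lemma dual_projection_comp X Y F G : oriented_tree e ->
  path_ideal e X -> path_ideal e Y ->
  dual_projection (span_ideal X) F -> dual_projection (span_ideal Y) G ->
  dual_projection (span_ideal (prod_ideal X Y)) (compF F G).
Proof.
by move=> ht idX idY [t tF] [t' tG]; exact: tens_dual_projection ht _ _ idX idY _ _ _ _ tF tG.
Qed.

Lemma span_full : span_ideal le = fun=> True.
Proof.
apply/funext => x; apply/propext; split=> // _ i j; exact: coef_le.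
Qed.

(** The indicator functions of [S] and its complement act as complementary idempotent bimodule
    endomorphisms, and each splits off a dual projection functor. *)
Lemma span_split X S F : path_ideal e X -> clopen e X S -> dual_projection (span_ideal X) F ->
  exists (F1 F2 : functor (fgmod_cat A) (fgmod_cat A)) (i1 : nattrans F1 F) (p1 : nattrans F F1)
    (i2 : nattrans F2 F) (p2 : nattrans F F2),
  [/\ dual_projection (span_ideal (split_ideal X S)) F1,
      dual_projection (span_ideal (split_ideal X (fun i j => ~~ S i j))) F2
    & hadd (comp (i1 : @hom (funcat _ _) F1 F) (p1 : @hom (funcat _ _) F F1))
       (comp (i2 : @hom (funcat _ _) F2 F) (p2 : @hom (funcat _ _) F F2)) = @idm (funcat _ _) F].
Proof.
move=> idX clS [t tF]; have spX := span_ideal_two_sided B idX.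
have summ S' : clopen e X S' ->
    exists (F1 : functor (fgmod_cat A) (fgmod_cat A)) (i : nattrans F1 F) (p : nattrans F F1),
    dual_projection (span_ideal (split_ideal X S')) F1 /\
    forall (M : fgmod A) x (m : M), span_ideal X x ->
      ncomp_lin (nvcomp i p) M (t M x m) = t M (diag B (fun i j => (S' i j)%:R) x) m.
  move=> clS'; pose c i j : k := (S' i j)%:R.
  have cE : bimod_endo (span_ideal X) (diag B c).
    by apply: diag_bimod_endo => // a i j b ai Xij jb; rewrite /c (clS' a i j b).
  have cc x : span_ideal X x -> diag B c (diag B c x) = diag B c x.
    move=> _; apply: (coef_inj B) => i j; rewrite !coef_diag /c.
    by case: (S' i j); rewrite ?mul1r ?mul0r.
  have [F1 [i [p [dp ip]]]] := dual_projection_summand spX tF cE cc.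
  exists F1, i, p; split=> //; suff <- : (fun x => span_ideal X x /\ diag B c x = x) =
    span_ideal (split_ideal X S') by [].
  apply/funext => x; apply/propext; split=> [[Xx <-] a b|Xx].
    rewrite coef_diag /c /split_ideal; case: (S' a b); last by rewrite mul0r eqxx.
    by rewrite mul1r andbT => /Xx.
  split=> [a b /Xx /andP[]//|]; apply: (coef_inj B) => a b; rewrite coef_diag /c.
  have [->|/Xx /andP[_ ->]] := eqVneq (coef a b x) 0; first by rewrite mulr0.
  exact: mul1r.
have [F1 [i1 [p1 [d1 ip1]]]] := summ S clS.
have [F2 [i2 [p2 [d2 ip2]]]] := summ _ (clopenC clS).
exists F1, F2, i1, p1, i2, p2; split=> //.
apply: (dual_projection_eq tF) => M x m Xx.
have [tT _ _] := tF.
rewrite [LHS](_ : _ =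
  ncomp_lin (nvcomp i1 p1) M (t M x m) + ncomp_lin (nvcomp i2 p2) M (t M x m)) //.
rewrite ip1 // ip2 // -(tensorDl (tT M)); last 2 first.
- by move=> a b; rewrite coef_diag mulf_eq0 negb_or => /andP[_ /Xx].
- by move=> a b; rewrite coef_diag mulf_eq0 negb_or => /andP[_ /Xx].
rewrite [RHS](_ : _ = t M x m) //; congr t; apply: (coef_inj B) => a b.
by rewrite coefD !coef_diag; case: (S a b); rewrite /= mul1r mul0r ?addr0 ?add0r.
Qed.

Lemma span_factors X F : path_ideal e X -> dual_projection (span_ideal X) F ->
  @factors (funcat _ _) (fun G => exists2 Y, conn_ideal e Y & dual_projection (span_ideal Y) G)
    F F (@idm (funcat _ _) F).
Proof.
move=> idX; move: X idX F; apply: path_ideal_ind =>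
  [X idX XN F dF|X cX F dF|X S idX clS IH1 IH2 F dF].
- rewrite [idm _](dual_projection_zero _ dF); first exact: Factors0.
  move=> x Xx; apply: (coef_inj B) => i j; rewrite coef0.
  by rewrite (span_coef0 Xx (XN i j)).
- rewrite -[idm _]comp1f -[X in @factors _ _ _ _ X](haddf0 (D := funcat _ _)).
  apply: (@FactorsS (funcat _ _)); last exact: Factors0.
  by exists X.
have [F1 [F2 [i1 [p1 [i2 [p2 [d1 d2 <-]]]]]]] := span_split idX clS dF.
apply: factorsD.
  rewrite -[p1 : @hom (funcat _ _) _ _](comp1f (p := funcat _ _)).
  exact/factorsM/IH1.
rewrite -[p2 : @hom (funcat _ _) _ _](comp1f (p := funcat _ _)).
exact/factorsM/IH2.
Qed.

End SpanIdeals.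

(** * The multisemigroup *)

Section Monoid.
Variables (k : fieldType) (n : nat) (e : rel 'I_n) (A : pzRingType).
Variable B : incidence_basis k (connect e) A.
Hypotheses (hn : (1 < n)%N) (ht : oriented_tree e) (hadm : admissible e).
Variables (C : preadd) (E : equivalence (fgmod_cat A) C).
Implicit Types (X Y Z : rel 'I_n) (D : functor (fgmod_cat A) (fgmod_cat A)).

Definition transport D : functor C C := conj_functor (eqv_to E) (eqv_from E) D.

Let spC : split_idempotents (funcat C C).
Proof. exact/split_funcat/(split_equivalence (eqv_toK E))/split_fgmod. Qed.

Let brick_transport D X : conn_ideal e X -> dual_projection (span_ideal B X) D ->
  @brick (funcat C C) (transport D).
Proof.
move=> cX dD; apply: conj_brick; [exact: eqv_to_additive | exact: eqv_from_additive
  | exact: eqv_toK | exact: eqv_fromK |].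
exact: span_brick dD.
Qed.

Let zero_transport D X : (forall i j, ~~ X i j) -> dual_projection (span_ideal B X) D ->
  @is_zero (funcat C C) (transport D).
Proof.
move=> X0 dD; red; rewrite -[idm _]/(@idm (funcat C C) (conj_functor (eqv_to E) (eqv_from E) D)).
rewrite -fmap1 [idm _](dual_projection_zero _ dD); first exact/fmap0/conj_additive/eqv_to_additive.
by move=> x Xx; apply: (coef_inj B) => i j; rewrite coef0 (span_coef0 Xx (X0 i j)).
Qed.

Let isom_transport D D' X : path_ideal e X ->
  dual_projection (span_ideal B X) D -> dual_projection (span_ideal B X) D' ->
  @isom (funcat C C) (transport D) (transport D').
Proof.
move=> idX dD dD'; apply: conj_isom.
exact: dual_projection_isom (span_ideal_two_sided B idX) dD dD'.
Qed.

Let one_morphism_transport D X : path_ideal e X -> dual_projection (span_ideal B X) D ->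
  one_morphism E (transport D).
Proof.
move=> idX dD; apply: AddGen; right; exists (span_ideal B X), D; split=> //.
  exact: span_ideal_two_sided.
exact: isom_refl.
Qed.

Let Gconn (F : functor C C) : Prop := exists X D,
  [/\ conn_ideal e X, dual_projection (span_ideal B X) D & F = transport D].

(** For the identity, the full ideal is used; a general two-sided ideal is the span of a relation,
    which [span_factors] breaks into connected pieces before transport to [C]. *)
Let one_morphism_factors F : one_morphism E F ->
  @factors (funcat C C) Gconn F F (@idm (funcat C C) F).
Proof.
have step D X : path_ideal e X -> dual_projection (span_ideal B X) D ->
    @factors (funcat C C) Gconn _ _ (@idm (funcat C C) (transport D)).
  move=> idX dD; have := span_factors idX dD.
  move/(conj_factors (eqv_to_additive E) (L := eqv_from E) (G' := Gconn)).
  rewrite fmap1; apply=> H [Y cY dH]; by exists Y, H.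
apply: add_closure_factors => {}F [Fid|[I [D [idI dD FD]]]].
  apply: factors_isom (isom_sym Fid) _.
  apply: factors_isom (isom_sym (conj_id (eqv_toK E))) _.
  apply: (@step _ (connect e)); first by case: (full_conn_ideal ht hn).
  rewrite span_full; exact: dual_projection_id.
have [X idX IX] := two_sided_span B idI; rewrite {}IX in dD.
exact: factors_isom (isom_sym FD) (step _ _ idX dD).
Qed.

Let indecomposable_class F : one_morphism E F -> @indecomposable (funcat C C) F ->
  exists X D, [/\ conn_ideal e X, dual_projection (span_ideal B X) D
    & @isom (funcat C C) F (transport D)].
Proof.
move=> oF iF; have Gb F' : Gconn F' -> @brick (funcat C C) F'.
  by move=> [X [D [cX dD ->]]]; exact: brick_transport cX dD.
have [F' [X [D [cX dD ->]]] DF] := indec_factors spC Gb iF (one_morphism_factors oF).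
by exists X, D; split=> //; exact: isom_sym.
Qed.

Local Notation S := (msemigroup E).

(** Elements are coded by relations; the external zero gets the empty relation, which [conn_ideal]
    excludes. *)
Definition represents (x : S) X : Prop :=
  if x is Some c then
    conn_ideal e X /\ exists2 D, dual_projection (span_ideal B X) D & sval c (transport D)
  else X = fun _ _ => false.

Let class_sym (c : {c : functor C C -> Prop | is_indec_class E c}) F :
  sval c F -> sval c = @isom (funcat C C) F.
Proof.
by case: c => c /= [F0 [_ _ ->]]; exact: (proj2 (@isom_classP (funcat C C) F0 F)).
Qed.

Lemma represents_ex x : exists X, represents x X.
Proof.
case: x => [[c [F [oF iF cE]]]|]; last by exists (fun _ _ => false).
have [X [D [cX dD FD]]] := indecomposable_class oF iF.
by exists X; split=> //; exists D => //=; rewrite cE.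
Qed.

Lemma represents_ideal x X : represents x X -> path_ideal e X.
Proof. by case: x => [c [[]]|->]. Qed.

(** Tensor functors of one ideal are isomorphic, so a relation determines its element. Identities
    between relations thereby become identities in the multisemigroup. *)
Lemma represents_inj x y X : represents x X -> represents y X -> x = y.
Proof.
case: x y => [c|] [d|] //=.
- move=> [[idX _ _] [D dD cD]] [_ [D' dD' dD'']]; congr Some.
  have cd : sval c = sval d.
    rewrite (class_sym cD) (class_sym dD'').
    apply: (proj2 (@isom_classP (funcat C C) _ _)).
    exact: isom_transport idX dD dD'.
  case: c d cd {cD dD''} => c cP [d dP] /= cd; subst d; congr exist; exact: Prop_irrelevance.
- by move=> [[_ [i [j +]] _] _] XE; rewrite XE.
- by move=> XE [[_ [i [j +]] _] _]; rewrite XE.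
Qed.

(** The functor [D] is an input: it is the identity for the unit and a composite for products. *)
Let class_of D X : conn_ideal e X -> dual_projection (span_ideal B X) D ->
  exists x : S, represents x X.
Proof.
move=> cX dD; have [idX _ _] := cX.
have P : is_indec_class E (@isom (funcat C C) (transport D)).
  exists (transport D); split=> //; first exact: one_morphism_transport dD.
  exact: brick_indecomposable (brick_transport cX dD).
exists (Some (exist _ _ P)); split=> //; exists D => //; exact: isom_refl.
Qed.

Lemma represents_one : exists x, represents x (connect e).
Proof.
apply: (@class_of (idF _)); first exact: full_conn_ideal.
rewrite span_full; exact: dual_projection_id.
Qed.

Let transport_comp D D' : @isom (funcat C C)
  (compF (transport D) (transport D')) (transport (compF D D')).
Proof. exact: conj_comp (eqv_fromK E) _ _. Qed.

Let prod_dichotomy X Y : conn_ideal e X -> conn_ideal e Y ->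
  prod_ideal X Y = (fun _ _ => false) \/ conn_ideal e (prod_ideal X Y).
Proof.
move=> cX cY; have [[i [j Zij]]|Z0] := pselect (exists i j, prod_ideal X Y i j).
  by right; exact: prod_conn_ideal Zij.
left; apply/funext => i; apply/funext => j; apply/negbTE/negP => Zij.
by apply: Z0; exists i, j.
Qed.

Let prod0l X : prod_ideal (fun _ _ => false) X = fun _ _ => false.
Proof.
by apply/funext => i; apply/funext => j; apply/existsP => -[l]; rewrite andbF.
Qed.

Let prod0r X : prod_ideal X (fun _ _ => false) = fun _ _ => false.
Proof. by apply/funext => i; apply/funext => j; apply/existsP => -[]. Qed.

Lemma represents_prod x y X Y : represents x X -> represents y Y ->
  exists z, represents z (prod_ideal X Y).
Proof.
case: x y => [c|] [d|] /=; last 3 first.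
- by move=> _ ->; exists None; rewrite /= prod0r.
- by move=> -> _; exists None; rewrite /= prod0l.
- by move=> -> _; exists None; rewrite /= prod0l.
move=> [cX [D dD cD]] [cY [D' dD' dD'']].
have [Z0|cZ] := prod_dichotomy cX cY; first by exists None.
case: cX cY => idX _ _ [idY _ _].
exact: class_of cZ (dual_projection_comp ht idX idY dD dD').
Qed.

(** The composite is isomorphic to the transported functor of the product ideal, which is zero or a
    brick; a brick has itself as its only nonzero summand up to isomorphism, so the product is
    single-valued. *)
Lemma mstar_represents x y z X Y : represents x X -> represents y Y ->
  mstar x y z <-> represents z (prod_ideal X Y).
Proof.
have None_or (w : S) Z : Z = (fun _ _ => false) -> w = None <-> represents w Z.
  move=> ->; case: w => [c|] //=; split=> //.
  by move=> [[_ [i [j]]]].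
case: x y => [c|] [d|] /=; last 3 first.
- by move=> _ ->; apply: None_or; rewrite prod0r.
- by move=> -> _; apply: None_or; rewrite prod0l.
- by move=> -> _; apply: None_or; rewrite prod0l.
move=> [cX [D dD cD]] [cY [D' dD' dD'']].
have idX : path_ideal e X by case: cX.
have idY : path_ideal e Y by case: cY.
have dZ := dual_projection_comp ht idX idY dD dD'.
have prod_isom F G : sval c F -> sval d G ->
    @isom (funcat C C) (compF F G) (transport (compF D D')).
  rewrite (class_sym cD) (class_sym dD'') => FD GD'.
  apply: isom_trans (transport_comp D D').
  by apply: comp_isom; exact: isom_sym.
have prod_zero F G : sval c F -> sval d G ->
    @is_zero (funcat C C) (compF F G) <-> prod_ideal X Y = (fun _ _ => false).
  move=> cF dG; have FG := prod_isom F G cF dG; split=> [FG0|Z0].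
    have [//|cZ] := prod_dichotomy cX cY.
    by have [+ _] := brick_transport cZ dZ => /(_ (is_zero_isom FG FG0)).
  apply: is_zero_isom (isom_sym FG) _; apply: zero_transport dZ => i j.
  by rewrite Z0.
split=> [[F [G [cF dG FGz]]]|rz].
  case: FGz => [[/(prod_zero _ _ cF dG) Z0 ->]//|[FG0 [h [H [-> hH HFG]]]]].
  have [Z0|cZ] := prod_dichotomy cX cY; first by case: FG0; apply/prod_zero.
  split=> //; exists (compF D D') => //.
  rewrite (class_sym hH); apply: isom_trans (prod_isom F G cF dG).
  apply: brick_summand HFG; first by
    exact: brick_isom (isom_sym (prod_isom F G cF dG)) (brick_transport cZ dZ).
  move=> H0; case: h hH => h [H' [_ [H'0 _] /= hE]]; rewrite hE => HH.
  by apply: H'0; apply: is_zero_isom (isom_sym HH) H0.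
exists (transport D), (transport D'); split=> //.
case: z rz => [h|] /=; last by left; split=> //; apply/prod_zero.
move=> [cZ [D1 dD1 hD1]]; right; split.
  move/(prod_zero _ _ cD dD'') => Z0; case: cZ => _ [i [j]]; by rewrite Z0.
exists h, (compF (transport D) (transport D')); split=> //; last exact: summand_refl.
rewrite (class_sym hD1); apply: isom_trans (isom_sym (transport_comp D D')).
by apply: isom_transport dD1 dZ; case: cZ.
Qed.

Lemma prod_idealA X Y Z : prod_ideal X (prod_ideal Y Z) = prod_ideal (prod_ideal X Y) Z.
Proof.
apply/funext => i; apply/funext => l; apply/existsP/existsP.
  move=> [j /andP[/existsP[h /andP[Zih Yhj]] Xjl]]; exists h; rewrite Zih.
  by apply/existsP; exists j; rewrite Yhj.
move=> [h /andP[Zih /existsP[j /andP[Yhj Xjl]]]]; exists j; rewrite Xjl andbT.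
by apply/existsP; exists h; rewrite Zih.
Qed.

Lemma prod_ideal1l X : path_ideal e X -> prod_ideal (connect e) X = X.
Proof.
move=> [Xle Xid]; apply/funext => i; apply/funext => l; apply/existsP/idP.
  by move=> [j /andP[Xij jl]]; apply: Xid Xij jl.
by exists l; rewrite connect0 andbT.
Qed.

Lemma prod_ideal1r X : path_ideal e X -> prod_ideal X (connect e) = X.
Proof.
move=> [Xle Xid]; apply/funext => i; apply/funext => l; apply/existsP/idP.
  by move=> [j /andP[ij Xjl]]; apply: Xid ij Xjl _.
by exists i; rewrite connect0.
Qed.

(** Through [represents], the laws become associativity of relational composition and the fact that
    reachability is neutral on ideals. *)
Lemma mstar_is_monoid : is_monoid (@mstar A C E).
Proof.
have ex (x y : S) : exists z, mstar x y z.
  have [X xX] := represents_ex x; have [Y yY] := represents_ex y.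
  by have [z zZ] := represents_prod xX yY; exists z; apply/(mstar_represents _ xX yY).
pose mul (x y : S) : S := sval (cid (ex x y)).
have mulP x y : mstar x y (mul x y) by exact: svalP.
have mul_rep x y X Y : represents x X -> represents y Y ->
    represents (mul x y) (prod_ideal X Y).
  by move=> xX yY; apply/(mstar_represents _ xX yY).
have [one oneP] := represents_one.
exists mul, one; split=> [x y z|x y z|x|x].
- have [X xX] := represents_ex x; have [Y yY] := represents_ex y.
  split=> [/(mstar_represents _ xX yY) zZ|->//].
  exact: represents_inj zZ (mul_rep _ _ _ _ xX yY).
- have [X xX] := represents_ex x; have [Y yY] := represents_ex y.
  have [Z zZ] := represents_ex z.
  have r1 := mul_rep _ _ _ _ xX (mul_rep _ _ _ _ yY zZ).
  have r2 := mul_rep _ _ _ _ (mul_rep _ _ _ _ xX yY) zZ.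
  by apply: represents_inj r1 _; rewrite prod_idealA.
- have [X xX] := represents_ex x; have := mul_rep _ _ _ _ oneP xX.
  by rewrite (prod_ideal1l (represents_ideal xX)) => /represents_inj; apply.
- have [X xX] := represents_ex x; have := mul_rep _ _ _ _ xX oneP.
  by rewrite (prod_ideal1r (represents_ideal xX)) => /represents_inj; apply.
Qed.
End Monoid.

Theorem corollary46 (k : closedFieldType) (n : nat) (e : rel 'I_n)
    (C : preadd) (E : equivalence (fgmod_cat (pathalg k e)) C)
    (hn : (1 < n)%N) (htree : oriented_tree e) (hadm : admissible e)
    (hK : Kset' e <> set0) :
  is_monoid (@mstar (pathalg k e) C E).
Proof. exact: mstar_is_monoid (path_basis k htree) hn htree hadm _ E. Qed.
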